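(* Let $\bar A=(A_0,A_1)$ be a compatible couple of (quasi-)Banach spaces with $A_0\cap A_1\neq\{0\}$. Let $0<\theta_0<\theta_1<1$, $0<\theta<1$, $0<r,r_0,r_1,q_0,q_1\le\infty$, $a,a_0,a_1,b_0,b_1\in SV$, $\left\|s^{-1/r_0}\frac{b_0(s)}{a_0(s)}\right\|_{r_0,(1,\infty)}<\infty$, and $\left\|s^{-1/r_1}\frac{b_1(s)}{a_1(s)}\right\|_{r_1,(1,\infty)}<\infty$. Put $c_0(t)=a_0(t)\left\|s^{-1/r_0}\frac{b_0(s)}{a_0(s)}\right\|_{r_0,(t,\infty)}$, $c_1(t)=a_1(t)\left\|s^{-1/r_1}\frac{b_1(s)}{a_1(s)}\right\|_{r_1,(t,\infty)}$, and $\rho(t)=t^{\theta_1-\theta_0}\frac{c_0(t)}{c_1(t)}$ for $t>0$. Then $$\left(\bar A^{\mathcal L}_{\theta_0,r_0,b_0,q_0,a_0},\bar A^{\mathcal L}_{\theta_1,r_1,b_1,q_1,a_1}\right)_{\theta,r,a}\cong\bar A_{\eta,r,a^{\#}},$$ where $\eta=(1-\theta)\theta_0+\theta\theta_1$ and $a^{\#}(t)=c_0(t)^{1-\theta}c_1(t)^{\theta}a(\rho(t))$.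
   Context: For a compatible couple $\bar X=(X_0,X_1)$ of (quasi-)Banach spaces, $f\in X_0+X_1$ and $t>0$, $K(t,f)=K(t,f;\bar X)=\inf\{\|f_0\|_{X_0}+t\|f_1\|_{X_1}: f=f_0+f_1,\ f_i\in X_i\}$. $\|\cdot\|_{q,(c,d)}$ ($0<q\le\infty$) is the usual (quasi-)norm of the Lebesgue space $L_q$ on the interval $(c,d)$ with Lebesgue measure (variable of integration: the displayed variable; $1/\infty=0$). $SV$ is the set of positive Lebesgue measurable functions $b$ on $(0,\infty)$ that are slowly varying: for each $\varepsilon>0$, $t^{\varepsilon}b(t)$ is equivalent to an increasing function and $t^{-\varepsilon}b(t)$ is equivalent to a decreasing function, where two positive functions are equivalent if each is bounded by a constant multiple of the other. For $0\le\theta\le1$, $0<q\le\infty$, $b\in SV$, $\bar X_{\theta,q,b}=(X_0,X_1)_{\theta,q,b}$ is the space of $f\in X_0+X_1$ with $\|f\|=\left\|u^{-\theta-1/q}b(u)K(u,f)\right\|_{q,(0,\infty)}<\infty$. For $0<\sigma<1$, $0<r,q\le\infty$, $a,b\in SV$, $\bar X^{\mathcal L}_{\sigma,r,b,q,a}$ is the space of $f\in X_0+X_1$ with $\|f\|=\left\|t^{-1/r}\frac{b(t)}{a(t)}\left\|u^{-\sigma-1/q}a(u)K(u,f)\right\|_{q,(0,t)}\right\|_{r,(0,\infty)}<\infty$. $X\cong Y$ means that $X$ and $Y$ are continuously embedded in each other (same space, equivalent quasi-norms). *)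

(* Defs.v *)
(* MathComp-Analysis, over an arbitrary [R : realType]. *)
From HB Require Import structures.
From mathcomp Require Import all_boot all_order all_algebra.
From mathcomp Require Import all_classical all_reals all_analysis.
Import Order.TTheory GRing.Theory Num.Theory.
Import numFieldNormedType.Exports.

Set Implicit Arguments.
Unset Strict Implicit.
Unset Printing Implicit Defensive.

Local Open Scope classical_set_scope.
Local Open Scope ring_scope.
Local Open Scope ereal_scope.

(* The real line with the sigma-algebra of Lebesgue measurable sets (the domain
   of [completed_lebesgue_measure]); on [R] itself the library puts the Borel
   sets. *)
Definition lebesgueR (R : realType) :=
  caratheodory_type (@wlength R idfun)^*%mu.

(* Quasi-norm of L_q(D), 0 < q <= +oo, w.r.t. Lebesgue measure. *)
Definition Lq (R : realType) (D : set R) (q : \bar R) (f : R -> \bar R)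
    : \bar R :=
  Lnorm (@completed_lebesgue_measure R) q (f \_ D).

(* 1/q, with 1/oo = 0. *)
Definition recip (R : realType) (q : \bar R) : R := fine q^-1.

(* Functions on (0, +oo) are represented by total functions on R whose values
   on (-oo, 0] are irrelevant. *)
Definition equivalent (R : realType) (f g : R -> R) : Prop :=
  exists C : R, (0 < C)%R /\
    forall t : R, (0 < t)%R -> (f t <= C * g t)%R /\ (g t <= C * f t)%R.

Definition slowly_varying (R : realType) (b : R -> R) : Prop :=
  [/\ forall t : R, (0 < t)%R -> (0 < b t)%R,
      measurable_fun (`]0%R, +oo[ : set (lebesgueR R)) (b : lebesgueR R -> R) &
      forall e : R, (0 < e)%R ->
        (exists g : R -> R,
          [/\ forall t : R, (0 < t)%R -> (0 < g t)%R,
              {in `]0%R, +oo[ &, {homo g : s t / (s <= t)%R}} &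
              equivalent (fun t => t `^ e * b t)%R g]) /\
        (exists g : R -> R,
          [/\ forall t : R, (0 < t)%R -> (0 < g t)%R,
              {in `]0%R, +oo[ &, {homo g : s t / (s <= t)%R >-> (t <= s)%R}} &
              equivalent (fun t => t `^ (- e) * b t)%R g])].

(* A (quasi-)normed space realized inside an ambient vector space [V]. Only the
   values of [qnorm] on [carrier] are meaningful. *)
Record qspace (R : realType) (V : lmodType R) := QSpace {
  carrier : set V ;
  qnorm : V -> \bar R }.

(* Scalars are real; complex spaces are covered by restriction of scalars,
   which changes neither the quasi-norm, nor completeness, nor the
   K-functional. Banach spaces are the case C = 1. *)
Definition quasi_banach (R : realType) (V : lmodType R) (X : qspace V) : Prop :=
  [/\ carrier X 0%R,
      forall x y, carrier X x -> carrier X y -> carrier X (x + y)%R &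
      forall (k : R) x, carrier X x -> carrier X (k *: x)%R] /\
  [/\ forall x, carrier X x -> 0 <= qnorm X x < +oo,
      forall x, carrier X x -> qnorm X x = 0 -> x = 0%R,
      forall (k : R) x, carrier X x -> qnorm X (k *: x)%R = `|k|%:E * qnorm X x &
      exists C : R, (1 <= C)%R /\
        forall x y, carrier X x -> carrier X y ->
          qnorm X (x + y)%R <= C%:E * (qnorm X x + qnorm X y)] /\
  forall u : nat -> V, (forall n, carrier X (u n)) ->
    (forall e : R, (0 < e)%R -> exists N : nat, forall m n : nat,
       (N <= m)%N -> (N <= n)%N -> qnorm X (u m - u n)%R < e%:E) ->
    exists l : V, carrier X l /\
      forall e : R, (0 < e)%R -> exists N : nat, forall n : nat,
        (N <= n)%N -> qnorm X (u n - l)%R < e%:E.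

Definition embeds_in_tvs (R : realType) (V : topologicalLmodType R)
    (X : qspace V) : Prop :=
  forall U : set V, nbhs (0%R : V) U ->
    exists d : R, (0 < d)%R /\
      forall x, carrier X x -> qnorm X x < d%:E -> U x.

Definition compatible_couple (R : realType) (V : topologicalLmodType R)
    (A0 A1 : qspace V) : Prop :=
  [/\ hausdorff_space V,
      quasi_banach A0 /\ quasi_banach A1 &
      embeds_in_tvs A0 /\ embeds_in_tvs A1].

Definition sum_set (R : realType) (V : lmodType R) (X0 X1 : qspace V) : set V :=
  [set f | exists f0 f1 : V,
     [/\ carrier X0 f0, carrier X1 f1 & f = (f0 + f1)%R]].

Definition Kfun (R : realType) (V : lmodType R) (X0 X1 : qspace V)
    (t : R) (f : V) : \bar R :=
  ereal_inf [set k | exists f0 f1 : V,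
    [/\ carrier X0 f0, carrier X1 f1, f = (f0 + f1)%R &
        k = qnorm X0 f0 + t%:E * qnorm X1 f1]].

(* (X_0, X_1)_{theta, q, b} *)
Definition interp_norm (R : realType) (V : lmodType R) (X0 X1 : qspace V)
    (theta : R) (q : \bar R) (b : R -> R) (f : V) : \bar R :=
  Lq `]0%R, +oo[ q
    (fun u => (u `^ (- theta - recip q) * b u)%:E * Kfun X0 X1 u f).

Definition interp (R : realType) (V : lmodType R) (X0 X1 : qspace V)
    (theta : R) (q : \bar R) (b : R -> R) : qspace V :=
  QSpace [set f | sum_set X0 X1 f /\ interp_norm X0 X1 theta q b f < +oo]
         (interp_norm X0 X1 theta q b).

(* (X_0, X_1)^L_{sigma, r, b, q, a} *)
Definition interpL_norm (R : realType) (V : lmodType R) (X0 X1 : qspace V)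
    (sigma : R) (r : \bar R) (b : R -> R) (q : \bar R) (a : R -> R) (f : V)
    : \bar R :=
  Lq `]0%R, +oo[ r
    (fun t => (t `^ (- recip r) * (b t / a t))%:E *
       Lq `]0%R, t[ q
         (fun u => (u `^ (- sigma - recip q) * a u)%:E * Kfun X0 X1 u f)).

Definition interpL (R : realType) (V : lmodType R) (X0 X1 : qspace V)
    (sigma : R) (r : \bar R) (b : R -> R) (q : \bar R) (a : R -> R)
    : qspace V :=
  QSpace [set f | sum_set X0 X1 f /\ interpL_norm X0 X1 sigma r b q a f < +oo]
         (interpL_norm X0 X1 sigma r b q a).

Definition cont_embedded (R : realType) (V : lmodType R) (X Y : qspace V)
    : Prop :=
  carrier X `<=` carrier Y /\
  exists C : R, (0 < C)%R /\
    forall f, carrier X f -> qnorm Y f <= C%:E * qnorm X f.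

Definition space_iso (R : realType) (V : lmodType R) (X Y : qspace V) : Prop :=
  cont_embedded X Y /\ cont_embedded Y X.

(* || s^{-1/r} b(s)/a(s) ||_{r, (t, +oo)} *)
Definition tail_norm (R : realType) (r : \bar R) (b a : R -> R) (t : R)
    : \bar R :=
  Lq `]t, +oo[ r (fun s => (s `^ (- recip r) * (b s / a s))%:E).

(* [fine] loses nothing: for slowly varying a, b, finiteness of the tail norm
   at t = 1 gives finiteness at every t > 0. *)
Definition tail_weight (R : realType) (r : \bar R) (b a : R -> R) (t : R) : R :=
  (a t * fine (tail_norm r b a t))%R.

(* Main.v *)
(* With [c_i(t) = a_i(t) ||s^(-1/r_i) b_i/a_i||_(r_i,(t,oo))], again slowly varying,
   the space [X_i] of type L behaves like a space of the classical scale with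
   exponent [theta_i] and weight [c_i]:
   (K) [s^(-theta_i) c_i(s) K(s,g) <= C ||g||_(X_i)], by restricting the inner norm
       to [(s/e, s)] and the outer one to [(s, oo)];
   (J) if [K(u,g) <= B u^theta_i / c_i(u) min(u/t, t/u)^d] for all [u], then
       [||g||_(X_i) <= C B].
   By (K), [K(u,f;A) <= C u^theta0 / c_0(u) K(rho(u),f;X)], which gives one embedding
   after the change of variable [v = rho(u)]. For the other one, apply (J) to the two
   pieces of a near-optimal decomposition of [f] at [t]: this bounds
   [rho(t)^(-theta) a(rho(t)) K(rho(t),f;X)] by
   [sup_s min(s/t, t/s)^d s^(-eta) a_sharp(s) K(s,f;A)], and the supremum is removed by
   a Hardy inequality. Everything is discretized on the points [e^n], n an integer,
   where both steps are instances of one inequality for kernels with exponential decay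
   ([lq_sup_kernel]), valid for all exponents in [(0, +oo]]. *)
Require Import Defs.
From HB Require Import structures.
From mathcomp Require Import all_boot all_order all_algebra.
From mathcomp Require Import all_classical all_reals all_analysis.
From mathcomp Require Import measurable_realfun ess_sup_inf ring lra.
Import Order.TTheory GRing.Theory Num.Theory.
Import numFieldNormedType.Exports.

Local Open Scope classical_set_scope.
Local Open Scope ring_scope.

Set Implicit Arguments.
Unset Strict Implicit.
Unset Printing Implicit Defensive.

(** * Regular variation *)

(** The weights are monotone only up to equivalence and a power, so [rho] need be neither monotone
    nor continuous, and [v = rho(u)] cannot be a substitution under an integral sign. What survives
    is that [ln rho] is a quasi-isometry of the variable [ln u]: it distorts distances by bounded
    factors up to an additive constant and comes within a bounded distance of every real. This
    suffices to transport sequences over the points [e^n]. Exponents below 1 rule out Minkowski's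
    inequality and duality, which is why the Hardy step goes through a supremum against a decaying
    kernel. The decay is paid for by four positive gaps, [theta (theta1 - theta0)],
    [(1 - theta) (theta1 - theta0)], [theta0] and [1 - theta1]; the rate [d] is the least of fixed
    fractions of them. Slow variation of [c_i] rests on the tails: a tail norm decreases in [t], and
    going back from [t] to [s] it grows at most like [(t/s)^e], because [b_i/a_i] at [t] is itself
    dominated by the tail norm at [t]. *)

(* Regular variation of index [k], up to equivalence, in the logarithmic
   variable: products, powers and compositions become linear arithmetic. *)
Definition regularly_varying (R : realType) (k : R) (b : R -> R) : Prop :=
  (forall t : R, 0 < t -> 0 < b t) /\
  forall e : R, 0 < e -> exists2 C : R, 0 <= C & forall s t : R, 0 < s -> 0 < t ->
    `|ln (b s) - ln (b t) - k * (ln s - ln t)| <= e * `|ln s - ln t| + C.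

Section RegularVariation.
Context {R : realType}.
Implicit Types (k l e s t : R) (a b : R -> R).

(** The comparison passes through [g] twice, hence [C ^+ 2]. Since [s] and [t] are not ordered, the
    same lemma serves an increasing and a decreasing [g]. *)
Lemma equivalent_le (f g : R -> R) : equivalent f g ->
  (forall t, 0 < t -> 0 < f t) ->
  exists2 C : R, 0 <= C & forall s t, 0 < s -> 0 < t -> 0 < g s -> g s <= g t ->
    ln (f s) <= ln (f t) + C.
Proof.
move=> [C [C0 fg]] f0; exists `|ln (C ^+ 2)| => // s t s0 t0 gs0 gst.
have [fs _] := fg s s0; have [_ gt] := fg t t0.
have le : f s <= C ^+ 2 * f t.
  rewrite expr2 -mulrA; apply: (le_trans fs).
  by rewrite ler_pM2l //; apply: (le_trans gst).
have C2 : 0 < C ^+ 2 by rewrite exprn_gt0.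
have := @ler_ln R (f s) (C ^+ 2 * f t).
rewrite !posrE f0 // mulr_gt0 ?f0 // => /(_ isT isT); rewrite le lnM ?posrE ?f0 //.
by move=> h; have := ler_norm (ln (C ^+ 2)); lra.
Qed.

Lemma ln_powRM (x y : R) e : 0 < x -> 0 < y -> ln (x `^ e * y) = e * ln x + ln y.
Proof. by move=> x0 y0; rewrite lnM ?posrE ?powR_gt0// ln_powR. Qed.

(** For [s <= t], the almost increasing [t^e b(t)] bounds [ln (b s) - ln (b t)] from above and the
    almost decreasing [t^(-e) b(t)] bounds it from below. *)
Lemma slowly_varying_rv b : slowly_varying b -> regularly_varying 0 b.
Proof.
move=> [b0 _ H]; split=> // e e0.
have [[g [g0 gi eg]] [h [h0 hd eh]]] := H e e0.
have [|C C0 HC] := equivalent_le eg.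
  by move=> t t0; rewrite mulr_gt0 ?powR_gt0 ?b0.
have [|D D0 HD] := equivalent_le eh.
  by move=> t t0; rewrite mulr_gt0 ?powR_gt0 ?b0.
exists (C + D); first by rewrite addr_ge0.
suff main s t : 0 < s -> 0 < t -> s <= t ->
    `|ln (b s) - ln (b t)| <= e * `|ln s - ln t| + (C + D).
  move=> s t s0 t0; rewrite mul0r subr0.
  have [st|ts] := leP s t; first exact: main.
  by rewrite distrC (distrC (ln s)) main // ltW.
move=> s0 t0 st.
have ls : ln s <= ln t by rewrite ler_ln.
have mem (x : R) : 0 < x -> x \in `]0%R, +oo[ by move=> x0; rewrite in_itv /= x0.
have h1 := HC s t s0 t0 (g0 _ s0) (gi _ _ (mem _ s0) (mem _ t0) st).
have h2 := HD t s t0 s0 (h0 _ t0) (hd _ _ (mem _ s0) (mem _ t0) st).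
move: h1 h2; rewrite !ln_powRM ?b0 // => h1 h2.
rewrite (ler0_norm (_ : ln s - ln t <= 0)) ?subr_le0 //.
by rewrite ler_norml; apply/andP; split; lra.
Qed.

Lemma rv_eq k a b : (forall t, 0 < t -> a t = b t) -> regularly_varying k a ->
  regularly_varying k b.
Proof.
move=> ab [a0 Ha]; split=> [t t0|e e0]; first by rewrite -ab ?a0.
by have [C C0 HC] := Ha e e0; exists C => // s t s0 t0; rewrite -!ab ?HC.
Qed.

Lemma rvM k l a b : regularly_varying k a -> regularly_varying l b ->
  regularly_varying (k + l) (fun t => a t * b t).
Proof.
move=> [a0 Ha] [b0 Hb]; split=> [t t0|e e0]; first by rewrite mulr_gt0 ?a0 ?b0.
have e2 : 0 < e / 2 by rewrite divr_gt0.
have [C C0 HC] := Ha _ e2; have [D D0 HD] := Hb _ e2.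
exists (C + D); first by rewrite addr_ge0.
move=> s t s0 t0; rewrite !lnM ?posrE ?a0 ?b0 //.
apply: le_trans (_ : `|(ln (a s) - ln (a t) - k * (ln s - ln t)) +
                       (ln (b s) - ln (b t) - l * (ln s - ln t))| <= _).
  by rewrite le_eqVlt; apply/orP; left; apply/eqP; congr Num.norm; lra.
apply: (le_trans (ler_normD _ _)).
by have := HC s t s0 t0; have := HD s t s0 t0; lra.
Qed.

Lemma rv_powR k l a : regularly_varying k a ->
  regularly_varying (l * k) (fun t => a t `^ l).
Proof.
move=> [a0 Ha]; split=> [t t0|e e0]; first by rewrite powR_gt0 ?a0.
have l0 : 0 < `|l| + 1 by rewrite ltr_wpDl.
have [C C0 HC] := Ha (e / (`|l| + 1)) (divr_gt0 e0 l0).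
exists (`|l| * C); first by rewrite mulr_ge0.
move=> s t s0 t0; rewrite !ln_powR.
rewrite (_ : _ - _ = l * (ln (a s) - ln (a t) - k * (ln s - ln t))); last by ring.
rewrite normrM; apply: (le_trans (ler_wpM2l (normr_ge0 _) (HC s t s0 t0))).
rewrite mulrDr lerD2r mulrA ler_wpM2r // mulrCA ler_piMr //; first exact: ltW.
by rewrite ler_pdivrMr // mul1r lerDl.
Qed.

Lemma rv_inv k a : regularly_varying k a -> regularly_varying (- k) (fun t => (a t)^-1).
Proof.
move=> [a0 Ha]; split=> [t t0|e e0]; first by rewrite invr_gt0 a0.
have [C C0 HC] := Ha _ e0; exists C => // s t s0 t0.
rewrite !lnV ?posrE ?a0 // -normrN; apply: le_trans (HC s t s0 t0).
by rewrite le_eqVlt; apply/orP; left; apply/eqP; congr Num.norm; lra.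
Qed.

Lemma rv_powid k : regularly_varying k (fun t => t `^ k).
Proof.
split=> [t t0|e e0]; first by rewrite powR_gt0.
exists 0 => // s t s0 t0; rewrite !ln_powR.
by rewrite -mulrBr subrr normr0 addr0 mulr_ge0 // ltW.
Qed.

(** In logarithms [b] is Lipschitz up to an additive constant, with slope [|k| + 1]; slow variation
    of [a] is therefore used with [e / (|k| + 1)]. *)
Lemma rv_comp k b a : regularly_varying k b -> regularly_varying 0 a ->
  regularly_varying 0 (fun t => a (b t)).
Proof.
move=> [b0 Hb] [a0 Ha]; split=> [t t0|e e0]; first by rewrite a0 ?b0.
have k0 : 0 < `|k| + 1 by rewrite ltr_wpDl.
have [C C0 HC] := Ha (e / (`|k| + 1)) (divr_gt0 e0 k0).
have [D D0 HD] := Hb 1 ltr01.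
have e' : 0 <= e / (`|k| + 1) by rewrite ltW // divr_gt0.
exists (e / (`|k| + 1) * D + C); first by rewrite addr_ge0 // mulr_ge0.
move=> s t s0 t0; rewrite mul0r subr0.
have := HC (b s) (b t) (b0 _ s0) (b0 _ t0); rewrite mul0r subr0 => h.
apply: (le_trans h); rewrite addrA lerD2r.
apply: (@le_trans _ _ (e / (`|k| + 1) * ((`|k| + 1) * `|ln s - ln t| + D))).
  rewrite ler_wpM2l //.
  rewrite -[X in `|X| <= _](subrK (k * (ln s - ln t))).
  apply: (le_trans (ler_normD _ _)); rewrite normrM.
  by have := HD s t s0 t0; lra.
by rewrite mulrDr lerD2r mulrA divfK ?gt_eqF.
Qed.

(** Potter's bound, the exponentiated form of the definition. *)
Lemma rv_bound k b e : regularly_varying k b -> 0 < e -> exists2 C : R, 0 < C &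
  forall s t, 0 < s -> 0 < t ->
    b s <= C * expR (k * (ln s - ln t) + e * `|ln s - ln t|) * b t.
Proof.
move=> [b0 Hb] e0; have [C C0 HC] := Hb _ e0.
exists (expR C) => [|s t s0 t0]; first exact: expR_gt0.
rewrite -[X in X <= _](@lnK _ (b s)) ?posrE ?b0 //.
rewrite -[X in _ <= _ * X](@lnK _ (b t)) ?posrE ?b0 // -!expRD ler_expR.
have := HC s t s0 t0; rewrite ler_norml => /andP[_ h]; lra.
Qed.

Lemma rv_local k b (L : R) : 0 <= L -> regularly_varying k b -> exists2 C : R, 0 < C &
  forall s t, 0 < s -> 0 < t -> `|ln s - ln t| <= L -> b s <= C * b t.
Proof.
move=> L0 [b0 Hb]; have [C C0 HC] := rv_bound (conj b0 Hb) ltr01.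
exists (C * expR ((`|k| + 1) * L)) => [|s t s0 t0 st]; first by rewrite mulr_gt0 ?expR_gt0.
apply: (le_trans (HC s t s0 t0)); rewrite ler_wpM2r //; first exact/ltW/b0.
rewrite ler_wpM2l ?ler_expR //; first exact: ltW.
rewrite mulrDl; apply: lerD; last by rewrite !mul1r.
by apply: (le_trans (ler_norm _)); rewrite normrM ler_wpM2l.
Qed.

(** Substitute for surjectivity, as [b] may jump. In the variable [x = ln t] the function [g] grows
    at least linearly, so [S] is nonempty and bounded above. A point [x] of [S] within 1 of its
    supremum satisfies [g x <= y < g (x + 1)], and [g] increases by at most [3k/2 + D] over a unit
    step. *)
Lemma rv_onto k b : 0 < k -> regularly_varying k b -> exists2 C : R, 0 <= C &
  forall y : R, exists2 t : R, 0 < t & `|ln (b t) - y| <= C.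
Proof.
move=> k0 [b0 Hb]; have k2 : 0 < k / 2 by rewrite divr_gt0.
have [D D0 HD] := Hb _ k2.
pose g x := ln (b (expR x)).
have Hg x y : `|g x - g y - k * (x - y)| <= k / 2 * `|x - y| + D.
  by have := HD _ _ (expR_gt0 x) (expR_gt0 y); rewrite !expRK.
exists (2 * k + D) => [|y]; first by lra.
pose S := [set x | g x <= y].
have S0 : S !=set0.
  (* The slope of [g] is at least [k/2] up to the error [D]; at distance [h] from 0 this outweighs
     both [D] and [|y - g 0|]. *)
  pose h := (`|y - g 0| + D) / (k / 2).
  have h0 : 0 <= h by rewrite divr_ge0 ?addr_ge0 // ltW.
  exists (- h); rewrite /S /=; have := Hg (- h) 0.
  rewrite subr0 normrN (ger0_norm h0) ler_norml => /andP[_].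
  have kh : k / 2 * h = `|y - g 0| + D by rewrite /h mulrC divfK ?gt_eqF.
  have := ler_norm (- (y - g 0)); rewrite normrN.
  by nra.
have Sub : has_ubound S.
  pose h := (`|y - g 0| + D) / (k / 2).
  have h0 : 0 <= h by rewrite divr_ge0 ?addr_ge0 // ltW.
  exists h => x; rewrite /S /= => gx; have [//|hx] := leP x h; exfalso.
  have x0 : 0 < x by apply: le_lt_trans hx.
  have := Hg x 0; rewrite subr0 (gtr0_norm x0) ler_norml => /andP[+ _].
  have kh : k / 2 * h = `|y - g 0| + D by rewrite /h mulrC divfK ?gt_eqF.
  have kx : k / 2 * h < k / 2 * x by rewrite ltr_pM2l.
  by have := ler_norm (y - g 0); lra.
have hs : has_sup S by [].
have [x Sx xs] := sup_adherent ltr01 hs.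
have nS : y < g (x + 1).
  rewrite ltNge; apply/negP => h.
  have := ub_le_sup Sub (h : S (x + 1)); lra.
exists (expR x); first exact: expR_gt0.
rewrite -/(g x); move: Sx; rewrite /S /= => Sx.
have x1 : x + 1 - x = 1 by ring.
have := Hg (x + 1) x; rewrite x1 normr1 ler_norml => /andP[_ h].
by rewrite ler_norml; apply/andP; split; lra.
Qed.

End RegularVariation.

(** * Quasi-norms of L_q, 0 < q <= +oo *)

Section LnormQuasi.
Context d (T : measurableType d) (R : realType).
Variable mu : {measure set T -> \bar R}.
Local Open Scope ereal_scope.
Implicit Types (f g : T -> \bar R) (q : \bar R).

(* The library's [ge0_le_integral] asks for measurability. *)
Lemma ge0_le_integralT f g : (forall x, 0 <= f x) -> (forall x, f x <= g x) ->
  \int[mu]_x f x <= \int[mu]_x g x.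
Proof.
move=> f0 fg; have g0 x : 0 <= g x by apply: le_trans (fg x).
rewrite !ge0_integralTE //; apply: ereal_sup_le => _ [h hf <-].
by exists h => // x; apply: le_trans (fg x); exact: hf.
Qed.

Lemma ge0_le_integral_set D f g : (forall x, D x -> 0 <= f x) ->
  (forall x, D x -> f x <= g x) ->
  \int[mu]_(x in D) f x <= \int[mu]_(x in D) g x.
Proof.
move=> f0 fg; rewrite !(integral_mkcond D); apply: ge0_le_integralT.
  exact: erestrict_ge0.
exact: lee_restrict.
Qed.

Lemma poweR_le (p : R) (x y : \bar R) : (0 <= p)%R -> 0 <= x -> x <= y ->
  x `^ p <= y `^ p.
Proof.
move=> p0 x0 xy; apply: gt0_ler_poweR => //; rewrite in_itv /= leey andbT //.
exact: le_trans xy.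
Qed.

Lemma Lnorm_le q f g : 0 < q -> (forall x, 0 <= f x) -> (forall x, f x <= g x) ->
  Lnorm mu q f <= Lnorm mu q g.
Proof.
move=> q0 f0 fg; rewrite unlock; case: q q0 => [p||//] p0.
- rewrite lte_fin in p0.
  apply: poweR_le; first by rewrite invr_ge0 ltW.
    by apply: integral_ge0 => x _; exact: poweR_ge0.
  apply: ge0_le_integralT => x; first exact: poweR_ge0.
  apply: poweR_le => //; first exact: ltW.
  by rewrite !gee0_abs // (le_trans (f0 x)).
- case: ifPn => // _; apply: le_ess_sup; apply/nearW => x /=.
  by rewrite !gee0_abs // (le_trans (f0 x)).
Qed.

Lemma LnormZ q f (k : R) : 0 < q -> (0 < k)%R -> measurable_fun setT f ->
  Lnorm mu q (fun x => k%:E * f x) = k%:E * Lnorm mu q f.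
Proof.
move=> q0 k0 mf; rewrite unlock; case: q q0 => [p||//] p0.
- rewrite lte_fin in p0.
  under eq_integral => x _ do
    rewrite abseM poweRM // gee0_abs ?lee_fin ?(ltW k0) // poweR_EFin.
  rewrite ge0_integralZl_EFin //; first last.
  + exact: powR_ge0.
  + apply: (@measurableT_comp _ _ _ _ _ _ (fun x => x `^ p)) => //.
      exact: measurable_poweR.
    exact: measurableT_comp.
  + by move=> x _; exact: poweR_ge0.
  rewrite poweRM ?lee_fin ?powR_ge0 //; last first.
    by apply: integral_ge0 => x _; exact: poweR_ge0.
  by rewrite poweR_EFin -powRrM mulfV ?gt_eqF // powRr1 // ltW.
- case: ifPn => [m0|_]; last by rewrite mule0.
  rewrite -ess_sup_pZl //; congr ess_sup.
  by apply/funext => x /=; rewrite abseM gee0_abs // lee_fin ltW.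
Qed.

Lemma LnormZ0 q f (k : R) : 0 < q -> (0 <= k)%R -> measurable_fun setT f ->
  Lnorm mu q (fun x => k%:E * f x) = k%:E * Lnorm mu q f.
Proof.
move=> q0; rewrite le_eqVlt => /orP[/eqP<- _|k0 mf]; last exact: LnormZ.
rewrite mul0e -[RHS](@Lnorm0 _ _ _ mu q) ?gt_eqF //; congr Lnorm.
by apply/funext => x; rewrite mul0e.
Qed.

(** The sum is at most twice the larger term, an argument that covers [p < 1] and [p >= 1] alike. *)
Lemma poweR_addM (p : R) (x y : \bar R) : (0 <= p)%R -> 0 <= x -> 0 <= y ->
  (x + y) `^ p <= ((2 : R) `^ p)%:E * (x `^ p + y `^ p).
Proof.
move=> p0; wlog xy : x y / x <= y.
  move=> H x0 y0; have [xy|/ltW yx] := leP x y; first exact: H.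
  by rewrite addeC (addeC (x `^ p)); exact: H.
move=> x0 y0; apply: (@le_trans _ _ ((2%:E * y) `^ p)).
  apply: poweR_le => //; first exact: adde_ge0.
  by rewrite mule_natl mule2n leeD2r.
rewrite poweRM ?lee_fin // poweR_EFin.
apply: lee_wpmul2l; first by rewrite lee_fin powR_ge0.
by rewrite leeDr // poweR_ge0.
Qed.

(** The elementary inequality is applied under the integral with exponent [p] and then to the two
    integrals with exponent [1/p], which gives the constant [2 * 2^(1/p)]. *)
Lemma Lnorm_triangle q : 0 < q -> exists2 C : R, (0 < C)%R &
  forall f g, measurable_fun setT f -> measurable_fun setT g ->
    (forall x, 0 <= f x) -> (forall x, 0 <= g x) ->
    Lnorm mu q (fun x => f x + g x) <= C%:E * (Lnorm mu q f + Lnorm mu q g).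
Proof.
rewrite unlock; case: q => [p||//] p0.
- rewrite lte_fin in p0; have p'0 : (0 <= p^-1)%R by rewrite invr_ge0 ltW.
  exists ((2 * 2 `^ (p^-1))%R) => [|f g mf mg f0 g0].
    by rewrite mulr_gt0 // powR_gt0.
  have int0 (h : T -> \bar R) : 0 <= \int[mu]_x `|h x| `^ p.
    by apply: integral_ge0 => x _; exact: poweR_ge0.
  have mp (h : T -> \bar R) : measurable_fun setT h ->
      measurable_fun setT (fun x => `|h x| `^ p).
    move=> mh; apply: (@measurableT_comp _ _ _ _ _ _ (fun x => x `^ p)) => //.
      exact: measurable_poweR.
    exact: measurableT_comp.
  have le1 : \int[mu]_x `|f x + g x| `^ p <=
      ((2 : R) `^ p)%:E * (\int[mu]_x `|f x| `^ p + \int[mu]_x `|g x| `^ p).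
    rewrite -ge0_integralD //; try (by move=> x _; exact: poweR_ge0);
      try exact: mp.
    have mfg : measurable_fun setT (fun x => `|f x| `^ p + `|g x| `^ p).
      by apply: emeasurable_funD; exact: mp.
    rewrite -ge0_integralZl_EFin //; first last.
      by move=> x _; rewrite adde_ge0 // poweR_ge0.
    apply: ge0_le_integralT => x; first exact: poweR_ge0.
    by rewrite !gee0_abs ?adde_ge0 //; apply: poweR_addM => //; exact: ltW.
  apply: (le_trans (poweR_le p'0 (int0 _) le1)).
  rewrite poweRM; [|by rewrite lee_fin powR_ge0|exact: adde_ge0 (int0 _) (int0 _)].
  rewrite poweR_EFin -powRrM mulfV ?gt_eqF // powRr1 // EFinM -muleA.
  by apply: lee_wpmul2l => //; exact: poweR_addM.
- exists 1%R => // f g mf mg f0 g0; rewrite mul1e.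
  case: ifPn => [m0|_]; last by rewrite adde0.
  apply: le_trans; last exact: ess_supD.
  apply: le_ess_sup; apply/nearW => x /=.
  by rewrite !gee0_abs // adde_ge0.
Qed.

End LnormQuasi.

(** * Sequence spaces indexed by the integers *)

Section EsumInt.
Context {R : realType}.
Local Open Scope ereal_scope.

(** Even numbers enumerate the nonnegative integers and odd ones the negative integers; this turns
    families indexed by [int] into sequences, to which countable additivity applies. *)
Definition nat_int (k : nat) : int := if odd k then Negz k./2 else Posz k./2.

Definition int_nat (n : int) : nat :=
  match n with Posz k => k.*2 | Negz k => k.*2.+1 end.

Lemma nat_intK : cancel nat_int int_nat.
Proof.
move=> k; rewrite /nat_int -[RHS]odd_double_half; case: ifP => ok /=.
  by rewrite add1n.
by rewrite add0n.
Qed.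

Lemma int_natK : cancel int_nat nat_int.
Proof.
case=> k; rewrite /nat_int /=; first by rewrite odd_double doubleK.
by rewrite odd_double /= uphalf_double.
Qed.

Lemma nat_int_bij : set_bij [set: nat] [set: int] nat_int.
Proof.
split=> [//|i j _ _ /(can_inj nat_intK)//|n _].
by exists (int_nat n) => //; rewrite int_natK.
Qed.

Lemma esumZ_le (T : choiceType) (c : R) (x : T -> \bar R) : (0 <= c)%R ->
  (forall i, 0 <= x i) ->
  \esum_(i in [set: T]) (c%:E * x i) <= c%:E * \esum_(i in [set: T]) x i.
Proof.
move=> c0 x0; apply: ge_ereal_sup => _ [F [Ffin _] <-].
rewrite -ge0_mule_fsumr //; apply: lee_wpmul2l; first by rewrite lee_fin.
by apply: esum_ge; exists F.
Qed.

Lemma esumZ (T : choiceType) (c : R) (x : T -> \bar R) : (0 < c)%R ->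
  (forall i, 0 <= x i) ->
  \esum_(i in [set: T]) (c%:E * x i) = c%:E * \esum_(i in [set: T]) x i.
Proof.
move=> c0 x0; have c0' := ltW c0; apply/eqP; rewrite eq_le esumZ_le //=.
rewrite -lee_pdivlMl //.
have cx i : 0 <= c%:E * x i by rewrite mule_ge0 // lee_fin ltW.
rewrite -[leLHS](@eq_esum _ _ _ (fun i => (c^-1)%:E * (c%:E * x i))).
  by apply: esumZ_le => //; rewrite invr_ge0 ltW.
by move=> i _; rewrite muleA -EFinM mulVf ?gt_eqF // mul1e.
Qed.

Lemma esum_exchange (T1 T2 : choiceType) (x : T1 -> T2 -> \bar R) :
  (forall i j, 0 <= x i j) ->
  \esum_(i in [set: T1]) \esum_(j in [set: T2]) x i j =
  \esum_(j in [set: T2]) \esum_(i in [set: T1]) x i j.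
Proof.
move=> x0; rewrite !esum_esum //.
rewrite (@reindex_esum R _ _ ([set: T2] `*`` (fun=> [set: T1])) _
  (fun p : T2 * T1 => (p.2, p.1))) //.
split=> [//|[i j] [i' j'] _ _ [-> ->]//|[i j] _].
by exists (j, i).
Qed.

Lemma esum_ge1 (T : choiceType) (x : T -> \bar R) i : (forall i, 0 <= x i) ->
  x i <= \esum_(i in [set: T]) x i.
Proof.
move=> x0; apply: esum_ge; exists [set i]; last by rewrite fsbig_set1.
by split.
Qed.

Lemma esum_geom_nat (d : R) : (0 < d)%R -> exists2 C : R, (0 <= C)%R &
  \esum_(k in [set: nat]) (expR (- d * k%:R))%:E <= C%:E.
Proof.
move=> d0; have e1 : (expR (- d) < 1)%R by rewrite -expR0 ltr_expR oppr_lt0.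
have e0 := expR_gt0 (- d).
exists (1 / (1 - expR (- d)))%R; first by rewrite divr_ge0 // subr_ge0 ltW.
rewrite -nneseries_esumT; last by move=> n; rewrite lee_fin expR_ge0.
apply: lime_le; first by apply: is_cvg_nneseries => n _; rewrite lee_fin expR_ge0.
apply/nearW => n; rewrite sumEFin lee_fin.
have := @geometric_le_lim R n 1%R (expR (- d)) ler01 e0.
rewrite gtr0_norm // => /(_ e1); apply: le_trans.
rewrite /series /= le_eqVlt; apply/orP; left; apply/eqP.
by apply: eq_bigr => k _; rewrite mul1r -expRM_natr mulr_natr.
Qed.

Lemma esum_geom (d : R) : (0 < d)%R -> exists2 C : R, (0 <= C)%R &
  \esum_(n in [set: int]) (expR (- d * `|n%:~R|))%:E <= C%:E.
Proof.
move=> d0; have [C C0 HC] := esum_geom_nat d0.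
exists (C + C)%R; first exact: addr_ge0.
rewrite (esumID [set n | (0 <= n)%R]); last first.
  by move=> n _; rewrite lee_fin expR_ge0.
rewrite EFinD; apply: leeD.
  rewrite (@reindex_esum R _ _ [set: nat] _ Posz).
    apply: le_trans HC; apply: le_esum => k _.
    by rewrite lee_fin -pmulrn ger0_norm.
  split=> [k _ //|i j _ _ []//|[k|k]]; last by case.
  by exists k.
rewrite (@reindex_esum R _ _ [set: nat] _ Negz).
  apply: le_trans HC; apply: le_esum => k _.
  rewrite lee_fin ler_expR NegzE mulrNz normrN -pmulrn ger0_norm //.
  by rewrite !mulNr lerN2; apply: ler_wpM2l; [exact: ltW|rewrite ler_nat].
split=> [k _ /=|i j _ _ []//|[k|k]]; first by split.
  by case=> _ /=; case.
by exists k.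
Qed.

(** The point is uniformity in [y]. Since [phi] separates indices linearly up to [C0], the sum is
    dominated by a geometric one centred at an index whose image is nearly closest to [y]. *)
Lemma esum_expR (phi : int -> R) (k C0 : R) (d : R) : (0 < d)%R -> (0 < k)%R ->
  (forall n m, k * `|n%:~R - m%:~R| - C0 <= `|phi n - phi m|)%R ->
  exists2 C : R, (0 < C)%R & forall y : R,
    \esum_(n in [set: int]) (expR (- d * `|phi n - y|))%:E <= C%:E.
Proof.
move=> d0 k0 Hphi.
have dk : (0 < d * k / 2)%R by rewrite divr_gt0 // mulr_gt0.
have [G G0 HG] := esum_geom dk.
(* [C0] is the defect of separation, 1 the defect of near-minimality of [n0], and the factor 1/2
   comes from [|phi n - phi n0| <= 2 |phi n - y| + 1]. *)
pose M := expR (d * (C0 + 1) / 2).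
have M0 : (0 < M)%R by exact: expR_gt0.
exists (M * G + 1)%R => [|y]; first by rewrite ltr_wpDl // mulr_ge0 // ltW.
pose D := [set `|phi n - y|%R | n in [set: int]].
have hD : has_inf D.
  split; first by exists (`|phi 0 - y|)%R; exists 0%R.
  by exists 0%R => _ [n _ <-].
(* [phi n0] is nearly the closest value to [y], so [|n - n0|] controls
   [|phi n - y|] from below. *)
have [_ [n0 _ <-] hn0] := inf_adherent ltr01 hD.
have near n : (`|phi n0 - y| <= `|phi n - y| + 1)%R.
  apply: (le_trans (ltW hn0)); rewrite lerD2r.
  by apply: ge_inf; [exact: hD.2|exists n].
have key n : (expR (- d * `|phi n - y|) <=
    M * expR (- (d * k / 2) * `|n%:~R - n0%:~R|))%R.
  rewrite -expRD ler_expR.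
  have h1 := Hphi n n0.
  have h2 : (`|phi n - phi n0| <= `|phi n - y| + `|phi n0 - y|)%R.
    rewrite (_ : phi n - phi n0 = (phi n - y) - (phi n0 - y))%R; last by ring.
    exact: ler_normB.
  have h3 := near n.
  have h4 : (k * `|n%:~R - n0%:~R| - C0 - 1 <= 2 * `|phi n - y|)%R by lra.
  have := ler_wpM2l (ltW d0) h4; nra.
apply: le_trans (_ : (M * G)%:E <= _); last by rewrite lee_fin lerDl.
apply: (@le_trans _ _
  (\esum_(n in [set: int]) (M%:E * (expR (- (d * k / 2) * `|n%:~R - n0%:~R|))%:E))).
  by apply: le_esum => n _; rewrite -EFinM lee_fin.
apply: (le_trans (esumZ_le _ _)); first exact: ltW.
  by move=> n; rewrite lee_fin expR_ge0.
rewrite EFinM; apply: lee_wpmul2l; first by rewrite lee_fin ltW.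
apply: le_trans HG.
rewrite (@reindex_esum R _ _ [set: int] _ (fun n : int => (n + n0)%R)).
  by apply: le_esum => n _; rewrite rmorphD /= addrK.
split=> [//|i j _ _ /addIr//|n _]; exists (n - n0)%R => //=.
by rewrite subrK.
Qed.

Definition lq (q : \bar R) (x : int -> \bar R) : \bar R :=
  match q with
  | p%:E => (\esum_(n in [set: int]) x n `^ p) `^ p^-1
  | +oo => ereal_sup (range x)
  | -oo => 0
  end.

Lemma lqZ q (c : R) x : 0 < q -> (0 < c)%R -> (forall n, 0 <= x n) ->
  lq q (fun n => c%:E * x n) <= c%:E * lq q x.
Proof.
case: q => [p||//] q0 c0 x0 /=; last first.
  apply: ge_ereal_sup => _ [n _ <-]; apply: lee_wpmul2l.
    by rewrite lee_fin ltW.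
  by apply: ereal_sup_ubound; exists n.
rewrite lte_fin in q0.
rewrite -[leLHS](_ : (\esum_(n in [set: int]) ((c `^ p)%:E * x n `^ p)) `^ p^-1 = _);
  last first.
  congr (_ `^ _); apply: eq_esum => n _.
  by rewrite poweRM ?lee_fin ?(ltW c0) // poweR_EFin.
rewrite esumZ ?powR_gt0 //; last by move=> n; exact: poweR_ge0.
rewrite poweRM ?lee_fin ?powR_ge0 //; last first.
  by apply: esum_ge0 => n _; exact: poweR_ge0.
by rewrite poweR_EFin -powRrM mulfV ?gt_eqF // powRr1 // ltW.
Qed.

Lemma lq_ge q x n : 0 < q -> (forall n, 0 <= x n) -> x n <= lq q x.
Proof.
case: q => [p||//] q0 x0 /=; last by apply: ereal_sup_ubound; exists n.
rewrite lte_fin in q0.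
rewrite -[leLHS](_ : (x n `^ p) `^ p^-1 = _); last first.
  by rewrite -poweRrM mulfV ?gt_eqF // poweRe1.
apply: poweR_le; [by rewrite invr_ge0 ltW|exact: poweR_ge0|].
by apply: (esum_ge1 n) => m; exact: poweR_ge0.
Qed.

(* For [q < +oo] the supremum is dominated by the l^q norm of its terms,
   so no restriction such as [1 <= q] is needed. *)
Lemma lq_sup_kernel q (d k C0 : R) (phi : int -> R) (K : int -> int -> R) :
  0 < q -> (0 < d)%R -> (0 < k)%R ->
  (forall n m, k * `|n%:~R - m%:~R| - C0 <= `|phi n - phi m|)%R ->
  (forall n m, 0 <= K n m <= expR (- d * `|phi n - m%:~R|))%R ->
  exists2 C : R, (0 < C)%R & forall x y,
    (forall n, 0 <= x n) -> (forall n, 0 <= y n) ->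
    (forall n, x n <= ereal_sup (range (fun m => (K n m)%:E * y m))) ->
    lq q x <= C%:E * lq q y.
Proof.
move=> q0 d0 k0 Hphi HK; case: q q0 => [p||//] p0; last first.
  exists 1%R => // x y x0 y0 xy; rewrite mul1e /=.
  apply: ge_ereal_sup => _ [n _ <-]; apply: (le_trans (xy n)).
  apply: ge_ereal_sup => _ [m _ <-].
  apply: (@le_trans _ _ (1 * y m)); last first.
    by rewrite mul1e; apply: ereal_sup_ubound; exists m.
  apply: lee_wpmul2r => //; rewrite lee_fin.
  have /andP[_ /le_trans] := HK n m; apply.
  by rewrite -expR0 ler_expR mulNr oppr_le0 mulr_ge0 // ltW.
rewrite lte_fin in p0.
have [C C1 HC] := esum_expR (mulr_gt0 d0 p0) k0 Hphi.
exists (C `^ p^-1)%R => [|x y x0 y0 xy /=]; first by rewrite powR_gt0.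
have K0 n m : 0 <= (K n m)%:E by case/andP: (HK n m).
have Kp n m : ((K n m)%:E * y m) `^ p <=
    (expR (- (d * p) * `|phi n - m%:~R|))%:E * y m `^ p.
  rewrite poweRM // poweR_EFin; apply: lee_wpmul2r; first exact: poweR_ge0.
  rewrite lee_fin.
  rewrite (_ : - (d * p) * _ = - d * `|phi n - m%:~R| * p)%R; last by ring.
  rewrite expRM; apply: ge0_ler_powR; first exact: ltW.
  - by rewrite nnegrE; case/andP: (HK n m).
  - by rewrite nnegrE expR_ge0.
  - by case/andP: (HK n m).
have xp n : x n `^ p <= \esum_(m in [set: int])
    ((expR (- (d * p) * `|phi n - m%:~R|))%:E * y m `^ p).
  set S := esum _ _.
  have S0 : 0 <= S.
    by apply: esum_ge0 => m _; rewrite mule_ge0 ?poweR_ge0 // lee_fin expR_ge0.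
  rewrite -[S]poweRe1 // -[1%R](@mulVf _ p) ?gt_eqF // poweRrM.
  apply: poweR_le => //; first exact: ltW.
  apply: (le_trans (xy n)); apply: ge_ereal_sup => _ [m _ <-].
  have z0 : 0 <= (K n m)%:E * y m by rewrite mule_ge0.
  rewrite -[leLHS]poweRe1 // -[1%R](@mulfV _ p) ?gt_eqF // poweRrM.
  apply: poweR_le; [by rewrite invr_ge0 ltW|exact: poweR_ge0|].
  apply: (le_trans (Kp n m)).
  apply: (esum_ge1 (x := fun m => _ * _) m) => j.
  by rewrite mule_ge0 ?poweR_ge0 // lee_fin expR_ge0.
rewrite -poweR_EFin -poweRM ?lee_fin ?(ltW C1) //; last first.
  by apply: esum_ge0 => n _; exact: poweR_ge0.
apply: poweR_le; first by rewrite invr_ge0 ltW.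
  by apply: esum_ge0 => n _; exact: poweR_ge0.
apply: (le_trans (le_esum (fun n _ => xp n))).
(* Summing over [n] before [m] leaves, for each [m], a sum of exponentials that [HC] bounds
   independently of [m]. *)
rewrite esum_exchange; last first.
  by move=> i j; rewrite mule_ge0 ?poweR_ge0 // lee_fin expR_ge0.
apply: (@le_trans _ _ (\esum_(m in [set: int]) (C%:E * y m `^ p))); last first.
  by apply: esumZ_le => [|m]; [exact: ltW|exact: poweR_ge0].
apply: le_esum => m _.
have [yoo|yfin] := eqVneq (y m `^ p) +oo.
  rewrite yoo gt0_muley ?lte_fin // leey.
  by [].
have -> : y m `^ p = (fine (y m `^ p))%:E.
  by rewrite fineK // ge0_fin_numE ?poweR_ge0 // ltey.
under eq_esum => n _ do rewrite muleC.
have z0 : (0 <= fine (y m `^ p))%R by rewrite fine_ge0 // poweR_ge0.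
apply: (le_trans (esumZ_le z0 _)); first by move=> n; rewrite lee_fin expR_ge0.
by rewrite muleC; apply: lee_wpmul2r; [rewrite lee_fin|exact: HC].
Qed.

End EsumInt.

(** * Discretization *)

Section Discretization.
Context {R : realType}.
Local Open Scope ereal_scope.
Implicit Types (q : \bar R) (F G : R -> \bar R) (D : set R).

(* Norm of L_q(D, du/u); for [q = +oo] the weight disappears since [1/q = 0]. *)
Definition Lq_log D q F : \bar R := Lq D q (fun u => (u `^ (- recip q))%:E * F u).

Lemma Lq_ge0 D q (f : R -> \bar R) : 0 <= Lq D q f.
Proof. exact: Lnorm_ge0. Qed.

Lemma eq_Lq D (p : \bar R) (f g : R -> \bar R) :
  (forall u, D u -> f u = g u) -> Lq D p f = Lq D p g.
Proof.
move=> fg; congr Lnorm; apply/funext => u; rewrite !patchE.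
by case: ifP => // /set_mem /fg.
Qed.

Lemma powR_recip (u e : R) (p : \bar R) : (0 < u)%R ->
  (u `^ (e - recip p) = u `^ (- recip p) * u `^ e)%R.
Proof. by move=> u0; rewrite addrC powRD //; apply/implyP => _; rewrite gt_eqF. Qed.

Lemma Lq_le D D' q (f g : R -> \bar R) : 0 < q -> D `<=` D' ->
  (forall u, D u -> 0 <= f u) -> (forall u, D u -> f u <= g u) ->
  (forall u, D' u -> 0 <= g u) ->
  Lq D q f <= Lq D' q g.
Proof.
move=> q0 DD f0 fg g0; apply: Lnorm_le => // x; first exact: erestrict_ge0.
apply: (le_trans (lee_restrict fg x)); exact: restrict_lee.
Qed.

Lemma Lq_log_le D D' q F G : 0 < q -> D `<=` D' ->
  (forall u, D u -> 0 <= F u) -> (forall u, D u -> F u <= G u) ->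
  (forall u, D' u -> 0 <= G u) ->
  Lq_log D q F <= Lq_log D' q G.
Proof.
move=> q0 DD F0 FG G0; apply: Lq_le => // u Du.
- by rewrite mule_ge0 ?lee_fin ?powR_ge0 ?F0.
- by rewrite lee_wpmul2l ?lee_fin ?powR_ge0 ?FG.
- by rewrite mule_ge0 ?lee_fin ?powR_ge0 ?G0.
Qed.

Definition cell (n : int) : set R := `[expR n%:~R, expR (n + 1)%:~R[.

Lemma cellP n (u : R) : cell n u -> (0 < u)%R /\ (n%:~R <= ln u < n%:~R + 1)%R.
Proof.
rewrite /cell /= in_itv /= => /andP[h1 h2].
have u0 : (0 < u)%R by apply: lt_le_trans h1; exact: expR_gt0.
by split=> //; rewrite -ler_expR -ltr_expR lnK ?posrE // h1 intrD in h2 *.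
Qed.

Lemma cell_floor n (u : R) : cell n u -> Num.floor (ln u) = n.
Proof.
move=> /cellP[u0 h]; apply/eqP; rewrite floor_eq.
by rewrite intrD.
Qed.

Lemma floor_cell (u : R) : (0 < u)%R -> cell (Num.floor (ln u)) u.
Proof.
move=> u0; have := floor_itv (ln u).
by rewrite /cell /= in_itv /= -ler_expR -ltr_expR lnK ?posrE.
Qed.

Lemma measurable_itvL (i : interval R) : measurable ([set` i] : set (lebesgueR R)).
Proof. apply: sub_caratheodory; exact: measurable_itv. Qed.

Lemma clm_itv (i : interval R) :
  @completed_lebesgue_measure R [set` i] = lebesgue_measure ([set` i] : set R).
Proof. by []. Qed.

Lemma clm_cell n : @completed_lebesgue_measure R (cell n) =
  (expR (n + 1)%:~R - expR n%:~R)%:E.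
Proof.
rewrite /cell clm_itv lebesgue_measure_itv /= lte_fin ltr_expR ltr_int.
by rewrite ltrDl ltr01 EFinB.
Qed.

(** The cells partition the half-line and the integrand is constant on each of them. *)
Lemma integral_cell (S : int -> \bar R) : (forall n, 0 <= S n) ->
  \int[@completed_lebesgue_measure R]_(u in `]0%R, +oo[) S (Num.floor (ln u)) =
  \esum_(n in [set: int]) (S n * (expR (n + 1)%:~R - expR n%:~R)%:E).
Proof.
move=> S0.
have -> : `]0%R, +oo[%classic = \bigcup_k cell (nat_int k).
  apply/seteqP; split=> [u /=|u [k _ /cellP[u0 _]]]; last by rewrite /= in_itv /= u0.
  rewrite in_itv /= andbT => u0.
  exists (int_nat (Num.floor (ln u))) => //; rewrite int_natK; exact: floor_cell.
have mc k : measurable (cell k : set (lebesgueR R)) by exact: measurable_itvL.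
have mS k : measurable_fun (cell k : set (lebesgueR R))
    ((fun u => S (Num.floor (ln u))) : lebesgueR R -> \bar R).
  apply: (@eq_measurable_fun _ _ _ _ _ (cst (S k))); last exact: measurable_cst.
  by move=> u; rewrite inE => /cell_floor ->.
have tc : trivIset setT (fun k => cell (nat_int k) : set (lebesgueR R)).
  apply/trivIsetP => i j _ _ ij; apply/seteqP; split=> // u [/cell_floor + /cell_floor].
  by move=> -> /(can_inj nat_intK) /eqP; rewrite (negPf ij).
rewrite (ge0_integral_bigcup _ (fun k => mc (nat_int k)) _ _ tc); first last.
- by move=> u _; exact: S0.
- by apply/measurable_fun_bigcup => k; [exact: mc|exact: mS].
rewrite nneseries_esumT; last by move=> k; apply: integral_ge0.
rewrite (@reindex_esum R _ _ _ _ nat_int _ nat_int_bij); apply: eq_esum => k _.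
rewrite -(clm_cell (nat_int k)) -(integral_cst _ (mc _)).
by apply: eq_integral => u; rewrite inE => /cell_floor ->.
Qed.

Lemma recip_fin (p : R) : p != 0%R -> recip p%:E = (p^-1)%R.
Proof. by move=> p0; rewrite /recip inver (negPf p0). Qed.

Lemma recip_pinfty : recip (+oo : \bar R) = 0%R.
Proof. by rewrite /recip invey. Qed.

(** At [+oo], [Lnorm] is the essential supremum only when the whole space has positive measure. *)
Lemma clm_setT_gt0 : 0 < @completed_lebesgue_measure R [set: R].
Proof.
apply: (@lt_le_trans _ _ (@completed_lebesgue_measure R (cell 0))).
  by rewrite clm_cell lte_fin subr_gt0 ltr_expR ltr_int.
by apply: le_measure => //; rewrite inE //; exact: measurable_itvL.
Qed.

Lemma Lq_pinftyE D (f : R -> \bar R) : (forall u, D u -> 0 <= f u) ->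
  Lq D +oo f = ess_sup (@completed_lebesgue_measure R) (f \_ D).
Proof.
move=> f0; rewrite /Lq unlock clm_setT_gt0; congr ess_sup.
by apply/funext => x /=; rewrite gee0_abs //; exact: erestrict_ge0.
Qed.

Lemma Lq_finE D (p : R) (f : R -> \bar R) : (p != 0)%R -> (forall u, D u -> 0 <= f u) ->
  Lq D p%:E f = (\int[@completed_lebesgue_measure R]_(u in D) f u `^ p) `^ p^-1.
Proof.
move=> p0 f0; rewrite /Lq unlock; congr (_ `^ _); rewrite [RHS](integral_mkcond (D : set (lebesgueR R))).
apply: eq_integral => x _; rewrite gee0_abs; last exact: erestrict_ge0.
by rewrite !patchE; case: ifP => // _; rewrite poweR0r.
Qed.

Lemma ln_cell_near n (u : R) : cell n u -> (`|ln u - ln (expR n%:~R)| <= 1)%R.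
Proof.
by move=> /cellP[_ /andP[h1 h2]]; rewrite expRK ger0_norm; lra.
Qed.

Lemma posI (u : R) : `]0%R, +oo[%classic u -> (0 < u)%R.
Proof. by rewrite /= in_itv /= andbT. Qed.

(* No measurability of [F] is needed: on [cell n] the integrand is squeezed
   between multiples of [F (e^n)] over the length of the cell. *)
Lemma Lq_log_le_lq q (M : R) : 0 < q -> (0 < M)%R -> exists2 C : R, (0 < C)%R &
  forall F, (forall u, (0 < u)%R -> 0 <= F u) ->
  (forall s t, (0 < s)%R -> (0 < t)%R -> (`|ln s - ln t| <= 1)%R ->
    F s <= M%:E * F t) ->
  Lq_log `]0%R, +oo[ q F <= C%:E * lq q (fun n => F (expR n%:~R)).
Proof.
case: q => [p||//] q0 M0; last first.
  exists M => // F F0 HF; rewrite /Lq_log recip_pinfty oppr0.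
  rewrite Lq_pinftyE; last first.
    by move=> u /posI u0; rewrite powRr0 mul1e F0.
  apply/ess_supP/nearW => u; rewrite patchE; case: ifP => [|_].
    rewrite inE => /posI u0; rewrite powRr0 mul1e.
    have cu := floor_cell u0.
    apply: (le_trans (HF _ _ u0 (expR_gt0 _) (ln_cell_near cu))).
    apply: lee_wpmul2l; first by rewrite lee_fin ltW.
    by apply: (lq_ge (x := fun n => F (expR n%:~R))) => // m; rewrite F0 ?expR_gt0.
  rewrite mule_ge0 ?lee_fin ?(ltW M0) //.
  apply: (@le_trans _ _ (F (expR 0%:~R))); first by rewrite F0 ?expR_gt0.
  by apply: (lq_ge (x := fun n => F (expR n%:~R))) => // m; rewrite F0 ?expR_gt0.
rewrite lte_fin in q0; have p0 : p != 0%R by rewrite gt_eqF.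
(* On [cell n] the density [1/u] is at most [e^(-n)] and the length is [e^n (e - 1)], so the cell
   has [du/u]-mass at most [e - 1]. *)
pose K : R := ((expR 1 - 1) * M `^ p)%R.
have K0 : (0 < K)%R.
  by rewrite mulr_gt0 ?powR_gt0 // subr_gt0 -expR0 ltr_expR.
exists (K `^ p^-1)%R; first by rewrite powR_gt0.
move=> F F0 HF; have E0 n : (0 < expR n%:~R :> R)%R by exact: expR_gt0.
have FE n : 0 <= F (expR n%:~R) by exact: F0.
rewrite /Lq_log recip_fin // Lq_finE //; last first.
  by move=> u /posI u0; rewrite mule_ge0 ?F0 // lee_fin powR_ge0.
have Fp0 n : 0 <= F (expR n%:~R) `^ p by exact: poweR_ge0.
rewrite -poweR_EFin [lq _ _]/lq -poweRM ?lee_fin ?(ltW K0) //; last first.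
  by apply: esum_ge0 => n _.
apply: poweR_le; first by rewrite invr_ge0 ltW.
  by apply: integral_ge0 => u _; exact: poweR_ge0.
pose S n : \bar R := ((expR n%:~R)^-1 * M `^ p)%:E * F (expR n%:~R) `^ p.
have S0 n : 0 <= S n.
  by rewrite mule_ge0 // lee_fin mulr_ge0 ?powR_ge0 // invr_ge0 ltW.
apply: (@le_trans _ _ (\int[@completed_lebesgue_measure R]_(u in `]0%R, +oo[)
   S (Num.floor (ln u)))).
  apply: (@ge0_le_integral_set _ (lebesgueR R)) => u; first by move=> _; exact: poweR_ge0.
  move=> /posI u0; have cu := floor_cell u0; rewrite /S; set n := Num.floor _ in cu *.
  rewrite poweRM ?lee_fin ?powR_ge0 ?F0 // poweR_EFin -powRrM mulNr mulVf //.
  rewrite EFinM -muleA; apply: lee_pmul.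
  - by rewrite lee_fin powR_ge0.
  - exact: poweR_ge0.
  - rewrite lee_fin powR_inv1; last exact: ltW.
    by rewrite lef_pV2 ?posrE //; case/cellP: cu => _ /andP[+ _];
      rewrite -ler_expR lnK ?posrE.
  - rewrite -poweR_EFin -poweRM ?lee_fin ?(ltW M0) //.
    apply: poweR_le; [exact: ltW|exact: F0|].
    exact: (HF _ _ u0 (E0 n) (ln_cell_near cu)).
rewrite integral_cell // -esumZ //.
apply: le_esum => n _; rewrite /S muleC muleA -EFinM.
apply: lee_wpmul2r => //; rewrite lee_fin /K intrD expRD mulr1z.
rewrite le_eqVlt; apply/orP; left; apply/eqP.
by have := E0 n; set x := expR n%:~R => x0; field; rewrite gt_eqF.
Qed.

(** On [cell n], [F] is at least [F (e^n) / M]. For finite [q] the [du/u]-mass of the cell is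
    bounded below; for [q = +oo] the cell has positive measure and cannot lie in the exceptional
    null set. *)
Lemma lq_le_Lq_log q (M : R) : 0 < q -> (0 < M)%R -> exists2 C : R, (0 < C)%R &
  forall F, (forall u, (0 < u)%R -> 0 <= F u) ->
  (forall s t, (0 < s)%R -> (0 < t)%R -> (`|ln s - ln t| <= 1)%R ->
    F s <= M%:E * F t) ->
  lq q (fun n => F (expR n%:~R)) <= C%:E * Lq_log `]0%R, +oo[ q F.
Proof.
case: q => [p||//] q0 M0; last first.
  exists M => // F F0 HF; rewrite /Lq_log recip_pinfty oppr0.
  rewrite Lq_pinftyE; last first.
    by move=> u /posI u0; rewrite powRr0 mul1e F0.
  set s := ess_sup _ _; apply: ge_ereal_sup => _ [n _ <-].
  rewrite leNgt; apply/negP => h.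
  have [N [mN N0 HN]] := ess_sup_ge (@completed_lebesgue_measure R)
    ((fun u => (u `^ 0)%:E * F u) \_ `]0%R, +oo[).
  have cN : cell n `<=` N.
    move=> u cu; apply: HN => /= Hu; move: h; rewrite ltNge => /negP; apply.
    have [u0 _] := cellP cu.
    apply: (le_trans (HF _ u (expR_gt0 _) u0 _)).
      by rewrite distrC; exact: ln_cell_near.
    apply: lee_wpmul2l; first by rewrite lee_fin ltW.
    apply: le_trans Hu; rewrite patchE ifT ?powRr0 ?mul1e //.
    by rewrite inE /= in_itv /= u0.
  have : @completed_lebesgue_measure R (cell n) <= 0.
    rewrite -N0; apply: le_measure => //; rewrite inE //; exact: measurable_itvL.
  rewrite clm_cell leNgt lte_fin subr_gt0 ltr_expR ltr_int.
  by rewrite ltrDl ltr01.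
rewrite lte_fin in q0; have p0 : p != 0%R by rewrite gt_eqF.
(* Now [1/u] is at least [e^(-n-1)] on the cell; times the length [e^n (e - 1)] this is
   [1 - 1/e]. *)
pose K : R := ((1 - expR (- 1)) * (M `^ p)^-1)%R.
have Mp : (0 < M `^ p)%R by rewrite powR_gt0.
have K0 : (0 < K)%R.
  by rewrite mulr_gt0 ?invr_gt0 // subr_gt0 -expR0 ltr_expR; lra.
exists ((K^-1) `^ p^-1)%R; first by rewrite powR_gt0 // invr_gt0.
move=> F F0 HF; have E0 n : (0 < expR n%:~R :> R)%R by exact: expR_gt0.
have FE n : 0 <= F (expR n%:~R) by exact: F0.
rewrite /Lq_log recip_fin // Lq_finE //; last first.
  by move=> u /posI u0; rewrite mule_ge0 ?F0 // lee_fin powR_ge0.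
have Fp0 n : 0 <= F (expR n%:~R) `^ p by exact: poweR_ge0.
have I0 : 0 <= \int[@completed_lebesgue_measure R]_(u in `]0%R, +oo[)
      ((u `^ (- p^-1))%:E * F u) `^ p.
  by apply: integral_ge0 => u _; exact: poweR_ge0.
rewrite -poweR_EFin [lq _ _]/lq -poweRM ?lee_fin ?invr_ge0 ?(ltW K0) //.
apply: poweR_le; first by rewrite invr_ge0 ltW.
  by apply: esum_ge0 => n _.
rewrite lee_pdivlMl //.
pose S n : \bar R :=
  ((expR (n + 1)%:~R)^-1 * (M `^ p)^-1)%:E * F (expR n%:~R) `^ p.
have S0 n : 0 <= S n.
  rewrite mule_ge0 // lee_fin mulr_ge0 // invr_ge0 ltW //.
apply: (@le_trans _ _ (\int[@completed_lebesgue_measure R]_(u in `]0%R, +oo[)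
   S (Num.floor (ln u)))); last first.
  apply: (@ge0_le_integral_set _ (lebesgueR R)) => u; first by move=> _; exact: S0.
  move=> /posI u0; have cu := floor_cell u0; rewrite /S; set n := Num.floor _ in cu *.
  rewrite poweRM ?lee_fin ?powR_ge0 ?F0 // poweR_EFin -powRrM mulNr mulVf //.
  rewrite EFinM -muleA; apply: lee_pmul.
  - by rewrite lee_fin invr_ge0 ltW.
  - by rewrite mule_ge0 // lee_fin invr_ge0 ltW.
  - rewrite lee_fin powR_inv1; last exact: ltW.
    rewrite lef_pV2 ?posrE //; case/cellP: cu => _ /andP[_].
    by rewrite -ltr_expR lnK ?posrE // intrD => /ltW.
  - rewrite lee_pdivrMl // -poweR_EFin -poweRM ?lee_fin ?(ltW M0) ?F0 //.
    apply: poweR_le; [exact: ltW|exact: FE|].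
    by apply: HF => //; rewrite distrC; exact: ln_cell_near.
rewrite integral_cell // -esumZ //.
apply: le_esum => n _; rewrite /S [leRHS]muleC muleA -EFinM.
apply: lee_wpmul2r => //; rewrite lee_fin /K intrD expRD mulr1z expRN.
rewrite le_eqVlt; apply/orP; left; apply/eqP.
have := E0 n; set x := expR n%:~R => x0; have := expR_gt0 (1 : R); set e := expR 1 => e0.
by field; rewrite !gt_eqF.
Qed.

(** The bound is uniform in [t], reflecting the dilation invariance of [du/u]; on the points [e^n]
    it becomes a geometric sum. *)
Lemma Lq_log_expR q (d : R) : 0 < q -> (0 < d)%R -> exists2 C : R, (0 < C)%R &
  forall t, (0 < t)%R ->
    Lq_log `]0%R, +oo[ q (fun u => (expR (- d * `|ln u - ln t|))%:E) <= C%:E.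
Proof.
move=> q0 d0; have M0 : (0 < expR d)%R by exact: expR_gt0.
have [C C0 HC] := Lq_log_le_lq q0 M0.
have [D D0 HD] : exists2 D : R, (0 < D)%R & forall t,
    lq q (fun n => (expR (- d * `|n%:~R - t|))%:E) <= D%:E.
  case: q q0 {HC} => [p||//] p0; last first.
    exists 1%R => // t; apply: ge_ereal_sup => _ [n _ <-].
    by rewrite lee_fin -expR0 ler_expR mulNr oppr_le0 mulr_ge0 // ltW.
  rewrite lte_fin in p0.
  have hphi (n m : int) : (1 * `|n%:~R - m%:~R| - 0 <= `|n%:~R - m%:~R| :> R)%R.
    by rewrite mul1r subr0.
  have [D D0 HD] := esum_expR (mulr_gt0 d0 p0) ltr01 hphi.
  exists (D `^ p^-1)%R => [|t /=]; first by rewrite powR_gt0.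
  rewrite -poweR_EFin; apply: poweR_le; first by rewrite invr_ge0 ltW.
    by apply: esum_ge0 => n _; rewrite lee_fin powR_ge0.
  apply: le_trans (HD t).
  apply: le_esum => n _; rewrite lee_fin -expRM.
  by rewrite ler_expR; lra.
exists (C * D)%R => [|t t0]; first exact: mulr_gt0.
apply: (le_trans (HC _ _ _)).
- by move=> u _; rewrite lee_fin expR_ge0.
- move=> s u s0 u0 su; rewrite -EFinM lee_fin -expRD ler_expR.
  have : (`|ln u - ln t| <= `|ln s - ln u| + `|ln s - ln t|)%R.
    rewrite (_ : ln u - ln t = (ln s - ln t) - (ln s - ln u))%R; last by ring.
    by rewrite [leRHS]addrC; exact: ler_normB.
  move=> h; have := ler_wpM2l (ltW d0) h; have := ler_wpM2l (ltW d0) su; nra.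
- rewrite EFinM; apply: lee_wpmul2l; first by rewrite lee_fin ltW.
  under [X in lq q X]funext => n do rewrite expRK.
  exact: HD.
Qed.

End Discretization.

(** * Measurability, splitting and lower bounds for norms with respect to du/u *)

Section LqLogTools.
Context {R : realType}.
Local Open Scope ereal_scope.
Implicit Types (q : \bar R) (F G : R -> \bar R) (D : set R).

(* On a bare [set R] the library would pick the Borel sigma-algebra. *)
Definition measurableL D : Prop := measurable (D : set (lebesgueR R)).
Definition mfunL D (f : R -> R) : Prop :=
  measurable_fun (D : set (lebesgueR R)) (f : lebesgueR R -> R).

Lemma mfunL_borel D (f : R -> R) : measurable_fun [set: R] f -> mfunL D f.
Proof.
move=> mf; apply: measurable_funTS => _ Y mY; rewrite setTI.
apply: sub_caratheodory; rewrite -[X in _ X]setTI; exact: mf.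
Qed.

Lemma mfunLM D (f g : R -> R) : mfunL D f -> mfunL D g -> mfunL D (fun u => f u * g u)%R.
Proof. by move=> mf mg; apply: measurable_funM. Qed.

Lemma mfunL_powR D (x : R) : mfunL D (fun u => u `^ x)%R.
Proof. by apply: mfunL_borel; exact: measurable_powR. Qed.

Lemma mfunL_expR D (d t : R) : mfunL D (fun u => expR (d * `|ln u - ln t|))%R.
Proof.
apply: mfunL_borel; apply: (measurableT_comp (@measurable_expR R)).
apply: measurable_funM => //; apply: measurableT_comp => //.
by apply: measurable_funB => //; exact: measurable_ln.
Qed.

Lemma mfunL_div D (f g : R -> R) : (forall u, D u -> 0 < g u)%R ->
  mfunL D f -> mfunL D g -> mfunL D (fun u => f u / g u)%R.
Proof.
move=> g0 mf mg.
apply: (@eq_measurable_fun _ _ (lebesgueR R) _ _ (fun u => f u * g u `^ (- 1))%R).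
  by move=> u /set_mem Du; rewrite powR_inv1 // ltW // g0.
apply: mfunLM => //.
exact: (measurableT_comp (measurable_powR (- 1)) mg).
Qed.

Lemma mfunLS D D' (f : R -> R) : measurableL D -> D' `<=` D ->
  mfunL D f -> mfunL D' f.
Proof. by move=> mD DD mf; apply: measurable_funS mf. Qed.

Lemma mfunL_restrict D (w f : R -> R) : measurableL D -> mfunL D f -> mfunL D w ->
  measurable_fun [set: lebesgueR R] ((fun u => (w u)%:E * (f u)%:E) \_ D).
Proof.
move=> mD mf mw; apply: (proj1 (@measurable_restrictT _ _ (lebesgueR R) _ D _ mD)).
apply: (@eq_measurable_fun _ _ (lebesgueR R) _ _ (EFin \o (fun u => w u * f u)%R)).
  by move=> u _; rewrite /= EFinM.
by apply/measurable_EFinP; exact: mfunLM.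
Qed.

Lemma Lq_logZ D q (k : R) (f : R -> R) : 0 < q -> (0 <= k)%R -> measurableL D ->
  mfunL D f ->
  Lq_log D q (fun u => k%:E * (f u)%:E) = k%:E * Lq_log D q (fun u => (f u)%:E).
Proof.
move=> q0 k0 mD mf; rewrite /Lq_log /Lq.
rewrite -(@LnormZ0 _ (lebesgueR R)) //; last first.
  by apply: mfunL_restrict => //; exact: mfunL_powR.
congr Lnorm; apply/funext => u; rewrite !patchE; case: ifP => _; last by rewrite mule0.
by rewrite muleCA.
Qed.

(** Quasi-triangle inequality in the form that splits a domain. Measurability is asked of the
    majorants [g1] and [g2] only, so that [F] may contain an inner norm as a function of the outer
    variable. *)
Lemma Lq_log_split q : 0 < q -> exists2 C : R, (0 < C)%R &
  forall D D1 D2 F (g1 g2 : R -> R), measurableL D1 -> measurableL D2 ->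
    mfunL D1 g1 -> mfunL D2 g2 ->
    (forall u, D u -> 0 <= F u) ->
    (forall u, D1 u -> 0 <= g1 u)%R -> (forall u, D2 u -> 0 <= g2 u)%R ->
    (forall u, D u -> (D1 u /\ F u <= (g1 u)%:E) \/ (D2 u /\ F u <= (g2 u)%:E)) ->
    Lq_log D q F <= C%:E * (Lq_log D1 q (fun u => (g1 u)%:E) +
                            Lq_log D2 q (fun u => (g2 u)%:E)).
Proof.
move=> q0.
have [C C0 HC] := Lnorm_triangle (@completed_lebesgue_measure R) q0.
exists C => // D D1 D2 F g1 g2 mD1 mD2 mg1 mg2 F0 g10 g20 FG; rewrite /Lq_log /Lq.
have w0 (u : R) : 0 <= (u `^ (- recip q))%:E by rewrite lee_fin powR_ge0.
have h1 : forall u, 0 <= ((fun u => (u `^ (- recip q))%:E * (g1 u)%:E) \_ D1) u.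
  by apply: erestrict_ge0 => u Du; rewrite mule_ge0 // lee_fin g10.
have h2 : forall u, 0 <= ((fun u => (u `^ (- recip q))%:E * (g2 u)%:E) \_ D2) u.
  by apply: erestrict_ge0 => u Du; rewrite mule_ge0 // lee_fin g20.
have mh1 := mfunL_restrict mD1 mg1 (mfunL_powR (- recip q)).
have mh2 := mfunL_restrict mD2 mg2 (mfunL_powR (- recip q)).
apply: le_trans (HC _ _ mh1 mh2 h1 h2).
apply: Lnorm_le => // u.
  by apply: erestrict_ge0 => v Dv; apply: mule_ge0; [exact: w0|exact: F0].
rewrite [leLHS]patchE; case: ifP => [/set_mem Du|_]; last exact: adde_ge0.
have [[D1u le1]|[D2u le2]] := FG u Du.
- apply: le_trans (leeDl _ (h2 u)); rewrite patchE mem_set //.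
  exact: lee_wpmul2l.
- apply: le_trans (leeDr _ (h1 u)); rewrite patchE mem_set //.
  exact: lee_wpmul2l.
Qed.

Definition left_cell (t : R) : set R := `](t * expR (- 1))%R, t[.

(** Since [1/u >= 1/t] on [left_cell t], its [du/u]-mass is at least [1 - 1/e], whatever [t]; for
    [q = +oo] its positive Lebesgue measure is enough. *)
Lemma Lq_log_ge q : 0 < q -> exists2 C : R, (0 < C)%R &
  forall D F (t : R) (c : \bar R), (0 < t)%R -> 0 <= c -> (forall u, D u -> 0 <= F u) ->
    left_cell t `<=` D ->
    (forall u, left_cell t u -> c <= F u) ->
    c <= C%:E * Lq_log D q F.
Proof.
have e1 : (expR (- 1) < 1 :> R)%R by rewrite -[ltRHS]expR0 ltr_expR oppr_lt0.
have e0 := expR_gt0 (- 1 : R).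
have itvlt (t : R) : (0 < t)%R -> (t * expR (- 1) < t)%R by move=> t0; rewrite gtr_pMr.
have itvpos (t u : R) : (0 < t)%R -> left_cell t u -> (0 < u < t)%R.
  move=> t0; rewrite /left_cell /= in_itv /= => /andP[h ->]; rewrite andbT.
  by apply: lt_trans h; rewrite mulr_gt0.
have mI (t : R) : measurableL (left_cell t) by exact: measurable_itvL.
have muI (t : R) : (0 < t)%R -> @completed_lebesgue_measure R (left_cell t) =
    (t * (1 - expR (- 1)))%:E.
  move=> t0; rewrite /left_cell clm_itv lebesgue_measure_itv /= lte_fin itvlt //.
  by rewrite -EFinB; congr EFin; ring.
case: q => [p||//] q0; last first.
  exists 1%R => // D F t c t0 c0 F0 DI cF.
  rewrite mul1e /Lq_log recip_pinfty oppr0 Lq_pinftyE; last first.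
    by move=> u Du; rewrite powRr0 mul1e F0.
  set s := ess_sup _ _; rewrite leNgt; apply/negP => h.
  have [N [mN N0 HN]] := ess_sup_ge (@completed_lebesgue_measure R)
    ((fun u => (u `^ 0)%:E * F u) \_ D).
  have IN : left_cell t `<=` N.
    move=> u Iu; apply: HN => /= Hu; move: h; rewrite ltNge => /negP; apply.
    apply: (le_trans (cF u Iu)).
    by move: Hu; rewrite patchE mem_set ?powRr0 ?mul1e //; exact: DI.
  have : @completed_lebesgue_measure R (left_cell t) <= 0.
    rewrite -N0; apply: le_measure => //; rewrite inE //; exact: mI.
  rewrite muI // lee_fin leNgt => /negP; apply.
  by rewrite mulr_gt0 // subr_gt0.
rewrite lte_fin in q0; have p0 : p != 0%R by rewrite gt_eqF.
pose k : R := (1 - expR (- 1))%R.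
have k0 : (0 < k)%R by rewrite subr_gt0.
exists ((k^-1) `^ p^-1)%R; first by rewrite powR_gt0 // invr_gt0.
move=> D F t c t0 c0 F0 DI cF.
apply: (@le_trans _ _ (((k^-1) `^ p^-1)%:E * Lq_log (left_cell t) p%:E (fun=> c))); last first.
  apply: lee_wpmul2l; first by rewrite lee_fin powR_ge0.
  by apply: Lq_log_le.
rewrite /Lq_log recip_fin // Lq_finE //; last first.
  by move=> u _; rewrite mule_ge0 // lee_fin powR_ge0.
rewrite -poweR_EFin -poweRM ?lee_fin ?invr_ge0 ?(ltW k0) //; last first.
  by apply: integral_ge0 => u _; exact: poweR_ge0.
rewrite -[leLHS]poweRe1 // -[1%R](@mulfV _ p) // poweRrM.
apply: poweR_le; [by rewrite invr_ge0 ltW|exact: poweR_ge0|].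
rewrite lee_pdivlMl //.
apply: (@le_trans _ _ (\int[@completed_lebesgue_measure R]_(u in left_cell t)
    cst ((t^-1)%:E * c `^ p) u)).
  rewrite (integral_cst _ (mI t)) [X in _ <= _ * X](muI _ t0) muleAC -EFinM.
  by rewrite mulKf ?gt_eqF.
apply: (@ge0_le_integral_set _ (lebesgueR R)) => u Iu.
  by rewrite /= mule_ge0 ?poweR_ge0 // lee_fin invr_ge0 ltW.
have /andP[u0 ut] := itvpos _ _ t0 Iu.
rewrite /= poweRM ?lee_fin ?powR_ge0 // poweR_EFin -powRrM mulNr mulVf //.
apply: lee_wpmul2r; first exact: poweR_ge0.
by rewrite lee_fin powR_inv1 ?lef_pV2 ?posrE ?ltW.
Qed.

End LqLogTools.

(** * Tails of slowly varying functions *)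

Section Tail.
Context {R : realType} (r : \bar R) (b a : R -> R).
Implicit Types s t e u : R.
Hypotheses (r0 : (0 < r)%E) (ha : slowly_varying a) (hb : slowly_varying b).
Hypothesis htail : (tail_norm r b a 1 < +oo)%E.

Let ratio t := b t / a t.
Let tail t := fine (tail_norm r b a t).

Lemma rv_ratio : regularly_varying 0 ratio.
Proof.
have := rvM (slowly_varying_rv hb) (rv_inv (slowly_varying_rv ha)).
by rewrite oppr0 addr0.
Qed.

Lemma ratio_gt0 t : 0 < t -> 0 < ratio t.
Proof. by case: rv_ratio => + _; apply. Qed.

Lemma mfunL_ratio D : D `<=` `]0, +oo[ -> mfunL D ratio.
Proof.
move=> D0; apply: (@mfunLS _ `]0, +oo[) => //; first exact: measurable_itvL.
case: ha hb => [a0 ma _] [_ mb _]; apply: mfunL_div => // u.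
by move=> /posI; exact: a0.
Qed.

Lemma itv_pos (t : R) : 0 < t -> `]t, +oo[ `<=` `]0, +oo[.
Proof.
move=> t0 u; rewrite /= !in_itv /= !andbT; exact: lt_trans.
Qed.

Lemma tail_normE t : tail_norm r b a t = Lq_log `]t, +oo[ r (fun s => (ratio s)%:E).
Proof. by congr Lq; apply/funext => s; rewrite EFinM. Qed.

Lemma tail_norm_ge0 t : (0 <= tail_norm r b a t)%E.
Proof. exact: Lq_ge0. Qed.

Lemma tail_norm_le s t : 0 < s -> s <= t ->
  (tail_norm r b a t <= tail_norm r b a s)%E.
Proof.
move=> s0 st; rewrite !tail_normE; apply: Lq_log_le => //.
- by move=> u; rewrite /= !in_itv /= !andbT; exact: le_lt_trans.
- move=> u; rewrite /= in_itv /= andbT => tu; rewrite lee_fin ltW // ratio_gt0 //.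
  by apply: lt_trans tu; exact: lt_le_trans st.
- move=> u; rewrite /= in_itv /= andbT => tu; rewrite lee_fin ltW // ratio_gt0 //.
  exact: lt_trans tu.
Qed.

Lemma ratio_le_tail_norm : exists2 C : R, 0 < C & forall t, 0 < t ->
  ((ratio t)%:E <= C%:E * tail_norm r b a t)%E.
Proof.
have [C C0 HC] := Lq_log_ge r0.
have [M M0 HM] := rv_local ler01 rv_ratio.
exists (M * C) => [|t t0]; first exact: mulr_gt0.
have e0 := expR_gt0 (1 : R).
have et0 : 0 < t * expR 1 by exact: mulr_gt0.
have ett : t * expR 1 * expR (- 1) = t by rewrite -mulrA -expRD subrr expR0 mulr1.
rewrite (EFinM M C) -muleA -lee_pdivrMl // tail_normE.
(* The left cell of [e t] is [(t, e t)], which lies in the domain of the tail at [t]. *)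
apply: (HC _ _ (t * expR 1)) => //.
- by rewrite mule_ge0 // lee_fin ?invr_ge0 ltW // ratio_gt0.
- move=> u /(itv_pos t0) /posI u0; by rewrite lee_fin ltW // ratio_gt0.
- by move=> u; rewrite /left_cell /= !in_itv /= ett => /andP[->].
- move=> u; rewrite /left_cell /= !in_itv /= ett => /andP[tu ut].
  have u0 := lt_trans t0 tu.
  rewrite lee_pdivrMl // -EFinM lee_fin; apply: HM => //.
  rewrite distrC ger0_norm ?subr_ge0 ?ler_ln ?posrE ?(ltW tu) // lerBlDr.
  by rewrite -[leLHS]/(ln u) addrC -[X in _ + X]expRK -lnM ?posrE // ler_ln ?posrE ?ltW.
Qed.

(** Split [(s, oo)] at [t]. Beyond [t] stands the tail at [t]. On [(s, t]], Potter's bound compares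
    [ratio u] with [ratio t], and [ratio t] is dominated by the tail at [t]. *)
Lemma tail_norm_growth e : 0 < e -> exists2 C : R, 0 < C & forall s t, 0 < s -> s <= t ->
  (tail_norm r b a s <= (C * expR (e * (ln t - ln s)))%:E * tail_norm r b a t)%E.
Proof.
move=> e0; have [C1 C10 H1] := Lq_log_split r0.
have [C2 C20 H2] := rv_bound rv_ratio e0.
have [C3 C30 H3] := Lq_log_expR r0 e0.
have [C4 C40 H4] := ratio_le_tail_norm.
exists (C1 * (C2 * C3 * C4 + 1)) => [|s t s0 st].
  by rewrite mulr_gt0 // ltr_wpDl // !mulr_ge0 // ltW.
have t0 := lt_le_trans s0 st.
have lst : ln s <= ln t by rewrite ler_ln.
(* Writing [(t/u)^e] as [(t/s)^e (u/s)^(-e)] leaves a function decaying away from [s], whose norm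
   over the whole half-line does not depend on [s] and [t]. *)
pose A := C2 * expR (e * (ln t - ln s)) * ratio t.
have rt0 := ltW (ratio_gt0 t0).
have A0 : 0 <= A.
  by apply: mulr_ge0 rt0; apply: mulr_ge0 (expR_ge0 _); exact: ltW.
pose g1 u := A * expR (- e * `|ln u - ln s|).
have mpos : measurableL (`]0, +oo[ : set R) by exact: measurable_itvL.
have split := H1 `]s, +oo[%classic `]0, +oo[%classic `]t, +oo[%classic (fun u => (ratio u)%:E) g1 ratio.
rewrite [leLHS]tail_normE.
apply: (le_trans (split _ _ _ _ _ _ _ _)) => //.
- exact: measurable_itvL.
- by apply: mfunLM; [apply: mfunL_borel; exact: measurable_cst|exact: mfunL_expR].
- exact/mfunL_ratio/itv_pos.
- by move=> u /(itv_pos s0) /posI u0; rewrite lee_fin ltW // ratio_gt0.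
- by move=> u _; rewrite mulr_ge0 // expR_ge0.
- by move=> u /(itv_pos t0) /posI u0; rewrite ltW // ratio_gt0.
- move=> u su; have /posI u0 := itv_pos s0 su.
  move: su; rewrite /= !in_itv /= !andbT => su.
  have [tu|ut] := ltP t u; [by right|left].
  split=> //; rewrite lee_fin; apply: (le_trans (H2 u t u0 t0)).
  rewrite mul0r add0r /g1 /A [leRHS]mulrAC; apply: ler_wpM2r => //.
  have lsu : ln s <= ln u by rewrite ler_ln ?posrE // ltW.
  have lut : ln u <= ln t by rewrite ler_ln.
  rewrite -mulrA -expRD; apply: ler_wpM2l; [exact: ltW|rewrite ler_expR].
  by rewrite ler0_norm ?subr_le0 // ger0_norm ?subr_ge0 //; lra.
rewrite -tail_normE EFinM -!muleA EFinM -muleA.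
apply: lee_wpmul2l; first by rewrite lee_fin ltW.
apply: (@le_trans _ _ ((C2 * C3 * C4 * expR (e * (ln t - ln s)))%:E * tail_norm r b a t
   + (expR (e * (ln t - ln s)))%:E * tail_norm r b a t)%E); last first.
  rewrite -ge0_muleDl ?lee_fin ?expR_ge0 //; last first.
    by rewrite !mulr_ge0 ?expR_ge0 // ltW.
  by rewrite muleA -EFinM -EFinD mulrDl mul1r.
apply: leeD; last first.
  rewrite lee_pemull ?tail_norm_ge0 // lee_fin -expR0 ler_expR mulr_ge0 ?subr_ge0 //.
  exact: ltW.
rewrite /g1; under [X in Lq_log _ _ X]funext => u do rewrite EFinM.
rewrite Lq_logZ //; last exact: mfunL_expR.
apply: (@le_trans _ _ (A%:E * C3%:E)%E).
  by apply: lee_wpmul2l; [rewrite lee_fin|exact: H3].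
rewrite /A -EFinM.
apply: (@le_trans _ _ ((C2 * C3 * expR (e * (ln t - ln s)))%:E * (ratio t)%:E)%E).
  by rewrite -EFinM lee_fin; lra.
rewrite (_ : C2 * C3 * C4 * _ = C2 * C3 * expR (e * (ln t - ln s)) * C4); last by ring.
rewrite [in leRHS]EFinM -muleA; apply: lee_wpmul2l; last exact: H4.
by rewrite lee_fin !mulr_ge0 ?expR_ge0 // ltW.
Qed.

Lemma tail_norm_lty t : 0 < t -> (tail_norm r b a t < +oo)%E.
Proof.
move=> t0; have [t1|t1] := leP 1 t.
  by apply: le_lt_trans htail; exact: tail_norm_le.
have [C C0 HC] := tail_norm_growth ltr01.
apply: (le_lt_trans (HC t 1 t0 (ltW t1))).
by apply: lte_mul_pinfty => //; rewrite lee_fin mulr_ge0 ?expR_ge0 // ltW.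
Qed.

Lemma tailK t : 0 < t -> (tail t)%:E = tail_norm r b a t.
Proof. by move=> t0; rewrite fineK // ge0_fin_numE ?tail_norm_lty // tail_norm_ge0. Qed.

Lemma ratio_le_tail : exists2 C : R, 0 < C & forall t, 0 < t -> ratio t <= C * tail t.
Proof.
have [C C0 HC] := ratio_le_tail_norm; exists C => // t t0.
by rewrite -lee_fin (EFinM C) tailK // HC.
Qed.

Lemma tail_gt0 t : 0 < t -> 0 < tail t.
Proof.
move=> t0; have [C C0 HC] := ratio_le_tail.
by rewrite -(pmulr_rgt0 _ C0); apply: lt_le_trans (HC t t0); exact: ratio_gt0.
Qed.

Lemma tail_le s t : 0 < s -> s <= t -> tail t <= tail s.
Proof.
move=> s0 st; have t0 := lt_le_trans s0 st.
by rewrite -lee_fin !tailK // tail_norm_le.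
Qed.

(** Monotonicity gives one side of the estimate, the growth bound the other. *)
Lemma rv_tail : regularly_varying 0 tail.
Proof.
split=> [t|e e0]; first exact: tail_gt0.
have [C C0 HC] := tail_norm_growth e0.
exists `|ln C| => // s t; rewrite mul0r subr0.
wlog st : s t / s <= t.
  move=> H s0 t0; have [st|/ltW ts] := leP s t; first exact: H.
  by rewrite distrC (distrC (ln s)); exact: H.
move=> s0 t0; have lst : ln s <= ln t by rewrite ler_ln.
have h1 : ln (tail t) <= ln (tail s) by rewrite ler_ln ?posrE ?tail_gt0 ?tail_le.
have : tail s <= C * expR (e * (ln t - ln s)) * tail t.
  by rewrite -lee_fin EFinM !tailK // HC.
rewrite -ler_ln ?posrE ?mulr_gt0 ?expR_gt0 ?tail_gt0 //.
rewrite !lnM ?posrE ?mulr_gt0 ?expR_gt0 ?tail_gt0 // expRK => h2.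
rewrite ger0_norm ?subr_ge0 // ler0_norm ?subr_le0 //.
by have := ler_norm (ln C); lra.
Qed.

Lemma rv_tail_weight : regularly_varying 0 (tail_weight r b a).
Proof. by have := rvM (slowly_varying_rv ha) rv_tail; rewrite addr0. Qed.

End Tail.

(** * The spaces of type L *)

Section Classes.
Context {R : realType} (sigma : R) (r : \bar R) (b : R -> R) (q : \bar R) (a : R -> R).
Implicit Types (s t e u : R) (k : R -> \bar R).
Hypotheses (r0 : (0 < r)%E) (q0 : (0 < q)%E).
Hypotheses (ha : slowly_varying a) (hb : slowly_varying b).
Hypothesis htail : (tail_norm r b a 1 < +oo)%E.
Local Open Scope ereal_scope.

Let c := tail_weight r b a.
Let tail t := fine (tail_norm r b a t).

(** The quasi-norm of type L as a functional of an arbitrary function [k] in place of [K(u, f)], so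
    that both class estimates become statements about functions on the half-line. *)
Definition normL k : \bar R := Lq_log `]0%R, +oo[ r (fun t => (b t / a t)%:E *
  Lq_log `]0%R, t[ q (fun u => (u `^ (- sigma) * a u)%:E * k u)).

(** On [(s/e, s)] the inequality [k s <= (s/u) k u] costs a factor at most [e], so for every [t > s]
    the inner norm is at least a fixed multiple of [x]. As [x] is a real constant it can be pulled
    out of the outer norm over [(s, oo)], leaving the tail norm that turns [a s] into [c s]. *)
Lemma classK : exists2 C : R, (0 < C)%R & forall k s, (0 < s)%R ->
  (forall u, (0 < u)%R -> 0 <= k u) -> k s \is a fin_num ->
  (forall u, (0 < u)%R -> (u <= s)%R -> k s <= (s / u)%:E * k u) ->
  (s `^ (- sigma) * c s)%:E * k s <= C%:E * normL k.
Proof.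
have [C1 C10 H1] := Lq_log_ge q0.
have rw := rvM (rv_powid (- sigma)) (slowly_varying_rv ha).
have [M M0 HM] := rv_local ler01 rw.
have e10 := expR_gt0 (1 : R)%R.
pose L : R := (M * expR 1 * C1)%R.
have L0 : (0 < L)%R by rewrite !mulr_gt0.
exists L => // k s s0 k0 ksfin kle.
pose x := (s `^ (- sigma) * a s * fine (k s))%R.
have ws0 : (0 < s `^ (- sigma) * a s)%R by case: rw => + _; apply.
have fks0 : (0 <= fine (k s))%R by rewrite fine_ge0 // k0.
have x0 : (0 <= x)%R by rewrite mulr_ge0 // ltW.
have inner t : (s < t)%R -> x%:E <= L%:E *
    Lq_log `]0%R, t[ q (fun u => (u `^ (- sigma) * a u)%:E * k u).
  move=> st; have Me : (0 < M * expR 1)%R by rewrite mulr_gt0.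
  rewrite /L (EFinM (M * expR 1) C1) -muleA -lee_pdivrMl //.
  apply: (H1 _ _ s) => //.
  - by rewrite mule_ge0 // lee_fin // invr_ge0 ltW.
  - move=> u; rewrite /= in_itv /= => /andP[u0 _]; apply: mule_ge0; last exact: k0.
    by rewrite lee_fin ltW //; case: rw => + _; apply.
  - move=> u; rewrite /left_cell /= !in_itv /= => /andP[h us].
    by rewrite (lt_trans _ h) ?mulr_gt0 ?expR_gt0 //= (lt_trans us st).
  - move=> u; rewrite /left_cell /= in_itv /= => /andP[su us].
    have se0 : (0 < s * expR (- 1))%R by rewrite mulr_gt0 ?expR_gt0.
    have u0 := lt_trans se0 su.
    have lsu : (`|ln s - ln u| <= 1)%R.
      rewrite ger0_norm ?subr_ge0 ?ler_ln ?posrE ?(ltW us) // lerBlDr addrC -lerBlDr.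
      have := su; rewrite -ltr_ln ?posrE // lnM ?posrE ?expR_gt0 // expRK.
      by move/ltW.
    rewrite lee_pdivrMl // /x -(fineK ksfin) EFinM fineK //.
    have w1 := HM _ _ s0 u0 lsu.
    apply: (@le_trans _ _ ((M * (u `^ (- sigma) * a u))%:E * ((expR 1)%:E * k u))).
      apply: lee_pmul; rewrite ?lee_fin //; [exact: ltW|exact: k0|].
      apply: (le_trans (kle u u0 (ltW us))); apply: lee_wpmul2r; first exact: k0.
      rewrite lee_fin ler_pdivrMr // mulrC -ler_pdivrMr // -expRN; exact: ltW.
    by rewrite [in leLHS]EFinM [in leRHS]EFinM -!muleA lee_wpmul2l ?lee_fin ?(ltW M0) // muleCA.
apply: (@le_trans _ _ (L%:E * ((L^-1 * x)%:E * tail_norm r b a s))).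
  rewrite muleA -EFinM mulVKf ?gt_eqF // /c /tail_weight /x -(fineK ksfin) -EFinM.
  rewrite -tailK // -EFinM lee_fin fineK //.
  by rewrite le_eqVlt; apply/orP; left; apply/eqP; ring.
apply: lee_wpmul2l; first by rewrite lee_fin ltW.
have Lx0 : (0 <= L^-1 * x)%R by rewrite mulr_ge0 // invr_ge0 ltW.
rewrite tail_normE -Lq_logZ //; last 2 first.
- exact: measurable_itvL.
- exact: (mfunL_ratio ha hb (itv_pos s0)).
have ratio0 u : (0 < u)%R -> (0 <= (b u / a u))%R.
  by move=> u0; exact/ltW/(ratio_gt0 ha hb u0).
apply: Lq_log_le => //.
- exact: itv_pos.
- by move=> u /(itv_pos s0) /posI u0; rewrite mule_ge0 ?lee_fin // ratio0.
- move=> u su; have /posI u0 := itv_pos s0 su.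
  rewrite muleC; apply: lee_wpmul2l; first by rewrite lee_fin ratio0.
  rewrite EFinM lee_pdivrMl //; apply: inner.
  by move: su; rewrite /= in_itv /= andbT.
- by move=> u /posI u0; rewrite mule_ge0 ?lee_fin ?ratio0 // Lq_ge0.
Qed.

(** Since [c = a * tail], the inner integrand is at most [B / tail u] times the decay. For [s <= t]
    the inner norm is of order [B / tail s] and keeps half of the decay; as
    [ratio s <= C3 * tail s], the outer integrand is then bounded by a decaying exponential. For
    [s > t] the inner norm is of order [B / tail t], and the outer norm of [ratio] over [(t, oo)] is
    exactly [tail t], so the two cancel. *)
Lemma classJ (d : R) : (0 < d)%R -> exists2 C : R, (0 < C)%R & forall k t (B : R),
  (0 < t)%R -> (0 <= B)%R -> (forall u, (0 < u)%R -> 0 <= k u) ->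
  (forall u, (0 < u)%R ->
    k u <= (B * (u `^ sigma / c u) * expR (- d * `|ln u - ln t|))%:E) ->
  normL k <= (C * B)%:E.
Proof.
move=> d0; have d20 : (0 < d / 2)%R by rewrite divr_gt0.
have [C1 C10 H1] := Lq_log_expR q0 d20.
have [C2 C20 H2] := rv_bound (rv_tail r0 ha hb htail) d20.
have [C3 C30 H3] := ratio_le_tail r0 ha hb htail.
have [C4 C40 H4] := Lq_log_split r0.
have [C5 C50 H5] := Lq_log_expR r0 d20.
have tail0 u : (0 < u)%R -> (0 < tail u)%R by exact: tail_gt0.
have a0 u : (0 < u)%R -> (0 < a u)%R by case: ha => + _ _; apply.
have ratio0 u : (0 < u)%R -> (0 < (b u / a u))%R by exact: ratio_gt0.
pose Q := (C1 + C2 * C1)%R.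
have Q0 : (0 < Q)%R by rewrite addr_gt0 // mulr_gt0.
exists (C4 * (Q * C3 * C5 + Q))%R.
  by rewrite mulr_gt0 // addr_gt0 // !mulr_gt0.
move=> k t B t0 B0 k0 kle.
have mexp (D : set R) e u : mfunL D (fun v => expR (e * `|ln v - ln u|)%R).
  exact: mfunL_expR.
have mpos s : measurableL (`]0%R, s[ : set R) by exact: measurable_itvL.
have mall : measurableL (`]0%R, +oo[ : set R) by exact: measurable_itvL.
pose G s := Lq_log `]0%R, s[ q (fun u => (u `^ (- sigma) * a u)%:E * k u).
have weighted u : (0 < u)%R -> (u `^ (- sigma) * a u)%:E * k u <=
    (B / tail u * expR (- d * `|ln u - ln t|))%:E.
  move=> u0; have us0 : (0 < u `^ sigma)%R by rewrite powR_gt0.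
  have w0 : (0 <= u `^ (- sigma) * a u)%R.
    by rewrite mulr_ge0 ?powR_ge0 // ltW // a0.
  apply: (@le_trans _ _ ((u `^ (- sigma) * a u)%:E *
      (B * (u `^ sigma / c u) * expR (- d * `|ln u - ln t|))%:E)).
    by apply: lee_wpmul2l; [rewrite lee_fin|exact: kle].
  rewrite -EFinM lee_fin le_eqVlt; apply/orP; left; apply/eqP.
  rewrite powRN /c /tail_weight -/(tail u); field.
  by rewrite !gt_eqF // ?a0 ?tail0.
(* The centre [y] will be [s] when [s <= t], and [t] when [s > t]. *)
have kernel s y (A : R) : (0 < s)%R -> (0 < y)%R -> (0 <= A)%R ->
    (forall u, (0 < u)%R -> (u < s)%R -> (u `^ (- sigma) * a u)%:E * k u <=
       (A * expR (- (d / 2) * `|ln u - ln y|))%:E) -> G s <= (A * C1)%:E.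
  move=> s0 y0 A0 HA; rewrite /G.
  apply: (@le_trans _ _ (Lq_log `]0%R, +oo[ q
     (fun u => A%:E * (expR (- (d / 2) * `|ln u - ln y|))%:E))).
    apply: Lq_log_le => //.
    - by move=> u; rewrite /= !in_itv /= andbT => /andP[].
    - move=> u; rewrite /= in_itv /= => /andP[u0 _].
      by rewrite mule_ge0 ?k0 // lee_fin mulr_ge0 ?powR_ge0 // ltW // a0.
    - by move=> u; rewrite /= in_itv /= => /andP[u0 us]; rewrite -EFinM HA.
    - by move=> u _; rewrite mule_ge0 // lee_fin expR_ge0.
  rewrite Lq_logZ // EFinM; apply: lee_wpmul2l; [by rewrite lee_fin|exact: H1].
(* For [u < s <= t], half of the decay from [t] to [u] is split at [s]: the stretch from [s] to [u]
   is integrated, the one from [t] to [s] is kept in [E]. Here [1 / tail u <= 1 / tail s] because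
   the tail decreases. *)
have G_low s : (0 < s)%R -> (s <= t)%R ->
    G s <= (Q * B * expR (- (d / 2) * `|ln s - ln t|) / tail s)%:E.
  move=> s0 st; have lst : (ln s <= ln t)%R by rewrite ler_ln.
  set E := expR _; have E0 : (0 < E)%R by exact: expR_gt0.
  have BE : (0 <= B / tail s * E)%R.
    by rewrite !mulr_ge0 ?invr_ge0 // ltW // tail0.
  apply: (le_trans (kernel s s (B / tail s * E)%R s0 s0 BE _)).
    move=> u u0 us; have lus : (ln u <= ln s)%R by rewrite ler_ln ?posrE // ltW.
    apply: (le_trans (weighted u u0)); rewrite lee_fin -[leRHS]mulrA.
    apply: ler_pM.
    - by rewrite divr_ge0 // ltW // tail0.
    - exact: expR_ge0.
    - apply: ler_wpM2l => //; rewrite lef_pV2 ?posrE ?tail0 //.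
      exact: (tail_le r0 ha hb htail u0 (ltW us)).
    - rewrite -expRD ler_expR.
      have lut := le_trans lus lst.
      have dist : (0 <= d * (ln t - ln u))%R by rewrite mulr_ge0 ?subr_ge0 // ltW.
      by rewrite !ler0_norm ?subr_le0 //; lra.
  rewrite lee_fin (_ : B / tail s * E * C1 = C1 * (B * E / tail s))%R; last by ring.
  rewrite (_ : Q * B * E / tail s = Q * (B * E / tail s))%R; last by ring.
  apply: ler_wpM2r; last by rewrite lerDl mulr_ge0 // ltW.
  by rewrite divr_ge0 // ?mulr_ge0 // ltW // tail0.
(* Half of the decay compensates for replacing [1 / tail u] by [1 / tail t]; the other half is
   integrated. *)
have G_high s : (t < s)%R -> G s <= (Q * B / tail t)%:E.
  move=> ts; have s0 := lt_trans t0 ts.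
  have BE : (0 <= B * C2 / tail t)%R.
    by rewrite !mulr_ge0 ?invr_ge0 // ltW // tail0.
  apply: (le_trans (kernel s t (B * C2 / tail t)%R s0 t0 BE _)).
    move=> u u0 _; apply: (le_trans (weighted u u0)); rewrite lee_fin.
    have := H2 t u t0 u0; rewrite mul0r add0r distrC => h.
    have iu : ((tail u)^-1 <= C2 * expR (d / 2 * `|ln u - ln t|) / tail t)%R.
      rewrite ler_pdivlMr ?tail0 // mulrC -ler_pdivlMr ?invr_gt0 ?tail0 //.
      by rewrite invrK.
    apply: (@le_trans _ _ (B * (C2 * expR (d / 2 * `|ln u - ln t|) / tail t) *
        expR (- d * `|ln u - ln t|))%R).
      by apply: ler_wpM2r; [exact: expR_ge0|exact: ler_wpM2l].
    have -> : (- d * `|ln u - ln t| =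
        - (d / 2) * `|ln u - ln t| + - (d / 2 * `|ln u - ln t|))%R by field.
    rewrite expRD expRN.
    set X := expR (d / 2 * _); have X0 : (0 < X)%R by exact: expR_gt0.
    rewrite le_eqVlt; apply/orP; left; apply/eqP; field.
    by rewrite !gt_eqF // tail0.
  rewrite lee_fin (_ : B * C2 / tail t * C1 = (C2 * C1) * (B / tail t))%R; last by ring.
  rewrite (_ : Q * B / tail t = Q * (B / tail t))%R; last by ring.
  apply: ler_wpM2r; last by rewrite lerDr ltW.
  by rewrite divr_ge0 // ltW // tail0.
pose g1 s := (Q * C3 * B * expR (- (d / 2) * `|ln s - ln t|))%R.
pose g2 s := (Q * B / tail t * (b s / a s))%R.
have A1 : (0 <= Q * C3 * B)%R by rewrite !mulr_ge0 // ltW.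
have A2 : (0 <= Q * B / tail t)%R.
  by rewrite !mulr_ge0 ?invr_ge0 // ltW // tail0.
have G0 s : 0 <= G s by exact: Lq_ge0.
have mr : mfunL `]t, +oo[ (fun s => b s / a s)%R by exact/(mfunL_ratio ha hb)/itv_pos.
apply: (le_trans (H4 _ `]0%R, +oo[%classic `]t, +oo[%classic _ g1 g2 _ _ _ _ _ _ _ _)) => //.
- exact: measurable_itvL.
- by apply: mfunLM => //; apply: mfunL_borel; exact: measurable_cst.
- by apply: mfunLM => //; apply: mfunL_borel; exact: measurable_cst.
- by move=> s /posI s0; apply: mule_ge0; [rewrite lee_fin ltW // ratio0|exact: G0].
- by move=> s _; rewrite mulr_ge0 // expR_ge0.
- move=> s /(itv_pos t0) /posI s0; apply: mulr_ge0 => //.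
  by rewrite ltW // ratio0.
- move=> s s0'; have /posI s0 := s0'; have rs := ltW (ratio0 s s0).
  have [st|ts] := leP s t; [left|right]; split=> //.
  + apply: (@le_trans _ _ ((b s / a s)%:E *
        (Q * B * expR (- (d / 2) * `|ln s - ln t|) / tail s)%:E)).
      by apply: lee_wpmul2l; [rewrite lee_fin|exact: G_low].
    rewrite -EFinM lee_fin /g1; set E := expR _.
    have -> : (b s / a s * (Q * B * E / tail s) = Q * B * E * (b s / a s / tail s))%R by ring.
    have -> : (Q * C3 * B * E = Q * B * E * C3)%R by ring.
    apply: ler_wpM2l; first by rewrite !mulr_ge0 ?expR_ge0 // ltW.
    by rewrite ler_pdivrMr ?tail0 // H3.
  + by rewrite /= in_itv /= andbT.
  + apply: (@le_trans _ _ ((b s / a s)%:E * (Q * B / tail t)%:E)).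
      by apply: lee_wpmul2l; [rewrite lee_fin|exact: G_high].
    by rewrite -EFinM lee_fin /g2 mulrC.
rewrite /g1 /g2.
under [X in _ * (Lq_log _ _ X + _) <= _]funext => s do rewrite EFinM.
under [X in _ * (_ + Lq_log _ _ X) <= _]funext => s do rewrite EFinM.
rewrite Lq_logZ // Lq_logZ //; last exact: measurable_itvL.
rewrite -tail_normE -tailK // -EFinM -/(tail t) divfK ?gt_eqF ?tail0 //.
rewrite -(mulrA C4) (EFinM C4); apply: lee_wpmul2l; first by rewrite lee_fin ltW.
rewrite (mulrDl (Q * C3 * C5)%R Q B) (EFinD (Q * C3 * C5 * B)); apply: leeD => //.
rewrite (_ : Q * C3 * C5 * B = Q * C3 * B * C5)%R; last by ring.
by rewrite (EFinM _ C5); apply: lee_wpmul2l; [rewrite lee_fin|exact: H5].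
Qed.

End Classes.

(** * K-functionals *)

Section KFunctional.
Context {R : realType} (V : lmodType R) (X0 X1 : qspace V).
Local Open Scope ereal_scope.
Implicit Types (s t u : R) (f g : V).
Hypotheses (N0 : forall x, carrier X0 x -> 0 <= qnorm X0 x)
           (N1 : forall x, carrier X1 x -> 0 <= qnorm X1 x).

Lemma Kfun_le t f0 f1 : carrier X0 f0 -> carrier X1 f1 ->
  Kfun X0 X1 t (f0 + f1)%R <= qnorm X0 f0 + t%:E * qnorm X1 f1.
Proof. by move=> c0 c1; apply: ereal_inf_lbound; exists f0, f1; split. Qed.

Lemma Kfun_ge0 t f : (0 < t)%R -> 0 <= Kfun X0 X1 t f.
Proof.
move=> t0; apply: le_ereal_inf_tmp => _ [f0 [f1 [c0 c1 _ ->]]].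
by rewrite adde_ge0 ?mule_ge0 ?N0 ?N1 // lee_fin ltW.
Qed.

Lemma Kfun_mono s t f : (0 < s)%R -> (s <= t)%R -> Kfun X0 X1 s f <= Kfun X0 X1 t f.
Proof.
move=> s0 st; apply: le_ereal_inf_tmp => _ [f0 [f1 [c0 c1 -> ->]]].
apply: (le_trans (Kfun_le s c0 c1)); apply: leeD => //.
by apply: lee_wpmul2r; rewrite ?N1 // lee_fin.
Qed.

Lemma Kfun_scale u s f : (0 < u)%R -> (u <= s)%R ->
  Kfun X0 X1 s f <= (s / u)%:E * Kfun X0 X1 u f.
Proof.
move=> u0 us; have s0 := lt_le_trans u0 us.
have su : (0 < s / u)%R by rewrite divr_gt0.
rewrite -lee_pdivrMl //; apply: le_ereal_inf_tmp => _ [f0 [f1 [c0 c1 -> ->]]].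
rewrite lee_pdivrMl //; apply: (le_trans (Kfun_le s c0 c1)).
rewrite ge0_muleDr ?N0 ?mule_ge0 ?N1 // ?lee_fin ?(ltW u0) //.
apply: leeD; last by rewrite muleA -EFinM divfK ?gt_eqF.
by rewrite lee_pemull ?N0 // lee_fin ler_pdivlMr // mul1r.
Qed.

Lemma Kfun_local (L : R) s t f : (0 <= L)%R -> (0 < s)%R -> (0 < t)%R ->
  (`|ln s - ln t| <= L)%R -> Kfun X0 X1 s f <= (expR L)%:E * Kfun X0 X1 t f.
Proof.
move=> L0 s0 t0 st; have [sle|/ltW tle] := leP s t.
  apply: (le_trans (Kfun_mono _ s0 sle)).
  by rewrite lee_pemull ?Kfun_ge0 // lee_fin -[leLHS]expR0 ler_expR.
apply: (le_trans (Kfun_scale _ t0 tle)).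
apply: lee_wpmul2r; first exact: Kfun_ge0.
rewrite lee_fin -[leLHS]lnK ?posrE ?divr_gt0 // ler_expR ln_div ?posrE //.
exact: le_trans (ler_norm _) st.
Qed.

Lemma Kfun_weight_local (k L : R) (b : R -> R) : (0 <= L)%R -> regularly_varying k b ->
  exists2 M : R, (0 < M)%R & forall f s t, (0 < s)%R -> (0 < t)%R ->
    (`|ln s - ln t| <= L)%R ->
    (b s)%:E * Kfun X0 X1 s f <= M%:E * ((b t)%:E * Kfun X0 X1 t f).
Proof.
move=> L0 rb; have [C C0 HC] := rv_local L0 rb; have b0 : forall t, (0 < t)%R -> (0 < b t)%R.
  by case: rb.
exists (C * expR L)%R => [|f s t s0 t0 st]; first by rewrite mulr_gt0 ?expR_gt0.
apply: (@le_trans _ _ ((C * b t)%:E * ((expR L)%:E * Kfun X0 X1 t f))).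
  apply: lee_pmul.
  - by rewrite lee_fin ltW // b0.
  - exact: Kfun_ge0.
  - by rewrite lee_fin HC.
  - exact: Kfun_local.
by rewrite !EFinM -!muleA lee_wpmul2l ?lee_fin ?(ltW C0) // muleCA.
Qed.

End KFunctional.

(** * K-functionals of a compatible couple *)

Section KFunctionalBanach.
Context {R : realType} (V : topologicalLmodType R) (A0 A1 : qspace V).
Local Open Scope ereal_scope.
Implicit Types (s t u : R) (f g : V).

Lemma qnorm_ge0 (A : qspace V) x : quasi_banach A -> carrier A x -> 0 <= qnorm A x.
Proof. by move=> [_ [[h _ _ _] _]] /h /andP[]. Qed.

Lemma qnorm_fin (A : qspace V) x : quasi_banach A -> carrier A x ->
  qnorm A x \is a fin_num.
Proof. by move=> [_ [[h _ _ _] _]] /h /andP[? ?]; rewrite ge0_fin_numE. Qed.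

Lemma carrier0 (A : qspace V) : quasi_banach A -> carrier A 0%R.
Proof. by move=> [[h _ _] _]. Qed.

Lemma carrierD (A : qspace V) x y : quasi_banach A -> carrier A x -> carrier A y ->
  carrier A (x + y)%R.
Proof. by move=> [[_ h _] _]; exact: h. Qed.

Lemma qnorm0 (A : qspace V) : quasi_banach A -> qnorm A 0%R = 0.
Proof.
move=> qA; have [_ [[_ _ h _] _]] := qA.
by have := h 0%R 0%R (carrier0 qA); rewrite scaler0 normr0 mul0e.
Qed.

Hypothesis hA : compatible_couple A0 A1.

Let q0 : quasi_banach A0. Proof. by case: hA => _ []. Qed.
Let q1 : quasi_banach A1. Proof. by case: hA => _ []. Qed.

Local Notation K := (Kfun A0 A1).

Lemma sum_setD f g : sum_set A0 A1 f -> sum_set A0 A1 g -> sum_set A0 A1 (f + g)%R.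
Proof.
move=> [f0 [f1 [c0 c1 ->]]] [g0 [g1 [d0 d1 ->]]].
exists (f0 + g0)%R, (f1 + g1)%R; split; try exact: carrierD.
by rewrite addrACA.
Qed.

Lemma sum_setl f : carrier A0 f -> sum_set A0 A1 f.
Proof. by move=> c; exists f, 0%R; split; rewrite ?addr0 //; exact: carrier0. Qed.

Lemma sum_setr f : carrier A1 f -> sum_set A0 A1 f.
Proof. by move=> c; exists 0%R, f; split; rewrite ?add0r //; exact: carrier0. Qed.

Lemma Kfun_ge0_couple t f : (0 < t)%R -> 0 <= K t f.
Proof. by apply: Kfun_ge0 => x; exact: qnorm_ge0. Qed.

Lemma Kfun_fin t f : (0 < t)%R -> sum_set A0 A1 f -> K t f \is a fin_num.
Proof.
move=> t0 [f0 [f1 [c0 c1 ->]]]; rewrite ge0_fin_numE ?Kfun_ge0_couple //.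
apply: (le_lt_trans (Kfun_le t c0 c1)).
by rewrite ltey_eq fin_numD fin_numM ?qnorm_fin.
Qed.

Lemma Kfun_lel t f : carrier A0 f -> K t f <= qnorm A0 f.
Proof.
move=> c; have := Kfun_le t c (carrier0 q1).
by rewrite addr0 qnorm0 // mule0 adde0.
Qed.

Lemma Kfun_ler t f : carrier A1 f -> K t f <= t%:E * qnorm A1 f.
Proof.
move=> c; have := Kfun_le t (carrier0 q0) c.
by rewrite add0r qnorm0 // add0e.
Qed.

(** Both components of [f] can be taken arbitrarily small, so [f] lies in every neighbourhood of 0
    of a Hausdorff space. This settles the degenerate case of near-optimal decompositions, where
    [K < 2 K] fails. *)
Lemma Kfun_eq0 t f : (0 < t)%R -> K t f = 0 -> f = 0%R.
Proof.
move=> t0 K0; have [hV _ [e0 e1]] := hA.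
suff nf B : nbhs (0%R : V) B -> B f.
  by apply: hV => A B /nbhs_singleton fA /nf fB; exists f.
move=> nB; have := @add_continuous V (0, 0)%R B.
rewrite /= addr0 => /(_ nB) [[U0 U1] /= [nU0 nU1] UB].
have [d0 [d00 H0]] := e0 _ nU0; have [d1 [d10 H1]] := e1 _ nU1.
have : K t f < (Num.min d0 (t * d1)%R)%:E.
  by rewrite K0 lte_fin lt_min d00 mulr_gt0.
move=> /ereal_inf_lt [_ [f0 [f1 [c0 c1 -> ->]]] lt].
apply: (UB (f0, f1)); split => /=.
- apply: H0 => //; apply: le_lt_trans (lt_le_trans lt _).
    by rewrite leeDl // mule_ge0 ?qnorm_ge0 // lee_fin ltW.
  by rewrite lee_fin ge_min lexx.
- apply: H1 => //; rewrite -(@lte_pmul2l _ t%:E) //.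
  apply: le_lt_trans (lt_le_trans lt _).
    by rewrite leeDr // qnorm_ge0.
  by rewrite -EFinM lee_fin ge_min lexx orbT.
Qed.

Lemma Kfun_decomposition t f : (0 < t)%R -> sum_set A0 A1 f ->
  exists f0 f1, [/\ carrier A0 f0, carrier A1 f1, f = (f0 + f1)%R &
    qnorm A0 f0 + t%:E * qnorm A1 f1 <= 2%:E * K t f].
Proof.
move=> t0 sf; have Kfin := Kfun_fin t0 sf.
have := Kfun_ge0_couple f t0; rewrite le_eqVlt => /orP[/eqP/esym K0|Kpos].
  exists 0%R, 0%R; split; [exact: carrier0|exact: carrier0| |].
    by rewrite addr0; exact: Kfun_eq0 K0.
  by rewrite !qnorm0 // mule0 adde0 K0 mule0.
have : K t f < 2%:E * K t f.
  by rewrite -(fineK Kfin) -EFinM lte_fin ltr_pMl ?ltr1n // fine_gt0 // Kpos ltey_eq Kfin.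
move=> /ereal_inf_lt [_ [f0 [f1 [c0 c1 fE ->]]] lt].
by exists f0, f1; split=> //; exact: ltW.
Qed.

Lemma Kfun_add : exists2 C : R, (0 < C)%R & forall t f g, (0 < t)%R ->
  sum_set A0 A1 f -> sum_set A0 A1 g -> K t (f + g)%R <= C%:E * (K t f + K t g).
Proof.
have [_ [[_ _ _ [C0 [C01 H0]]] _]] := q0.
have [_ [[_ _ _ [C1 [C11 H1]]] _]] := q1.
pose C := (C0 + C1)%R.
have C00 : (0 <= C0)%R by apply: le_trans C01.
have C10 : (0 <= C1)%R by apply: le_trans C11.
have C0C : (C0 <= C)%R by rewrite lerDl.
have C1C : (C1 <= C)%R by rewrite lerDr.
have Cpos : (0 < C)%R by apply: lt_le_trans C0C; apply: lt_le_trans C01.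
exists (C * 2)%R => [|t f g t0 sf sg]; first by rewrite mulr_gt0.
have [f0 [f1 [c0 c1 -> hf]]] := Kfun_decomposition t0 sf.
have [g0 [g1 [d0 d1 -> hg]]] := Kfun_decomposition t0 sg.
have te : 0 <= t%:E by rewrite lee_fin ltW.
rewrite addrACA.
apply: (le_trans (Kfun_le t (carrierD q0 c0 d0) (carrierD q1 c1 d1))).
apply: (@le_trans _ _ (C%:E * ((qnorm A0 f0 + t%:E * qnorm A1 f1) +
                               (qnorm A0 g0 + t%:E * qnorm A1 g1)))).
  rewrite addeACA -ge0_muleDr ?qnorm_ge0 // [C%:E * _]ge0_muleDr ?adde_ge0 ?mule_ge0 ?adde_ge0 ?qnorm_ge0 //.
  apply: leeD.
    apply: (le_trans (H0 _ _ c0 d0)); apply: lee_wpmul2r; last by rewrite lee_fin.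
    by rewrite adde_ge0 ?qnorm_ge0.
  rewrite muleCA; apply: lee_wpmul2l => //.
  apply: (le_trans (H1 _ _ c1 d1)); apply: lee_wpmul2r; last by rewrite lee_fin.
  by rewrite adde_ge0 ?qnorm_ge0.
rewrite EFinM -muleA; apply: lee_wpmul2l; first by rewrite lee_fin ltW.
by rewrite ge0_muleDr ?Kfun_ge0_couple //; exact: leeD.
Qed.

End KFunctionalBanach.

(** * Reiteration *)

Section Reiteration.
Context {R : realType} (V : topologicalLmodType R) (A0 A1 X0 X1 : qspace V).
Context (s0 s1 theta : R) (r : \bar R) (c0 c1 a : R -> R).
Implicit Types (s t u : R) (f g : V).
Hypotheses (hA : compatible_couple A0 A1) (s0_gt0 : 0 < s0) (s01 : s0 < s1)
  (s1_lt1 : s1 < 1) (theta_gt0 : 0 < theta) (theta_lt1 : theta < 1) (r_gt0 : (0 < r)%E).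
Hypotheses (rc0 : regularly_varying 0 c0) (rc1 : regularly_varying 0 c1)
  (ra : regularly_varying 0 a).
Hypotheses (X0_ge0 : forall g, (0 <= qnorm X0 g)%E) (X1_ge0 : forall g, (0 <= qnorm X1 g)%E).
Hypotheses
  (X0E : carrier X0 = [set g | sum_set A0 A1 g /\ (qnorm X0 g < +oo)%E])
  (X1E : carrier X1 = [set g | sum_set A0 A1 g /\ (qnorm X1 g < +oo)%E]).

(* Membership of [X] in the two classes of exponent [sigma] and weight [c] with
   respect to [(A0, A1)]; [class_J] is stated through the K-functional, so that
   no sum of a series of pieces is required. *)
Definition class_K (X : qspace V) (sigma : R) (c : R -> R) : Prop :=
  exists2 C : R, 0 < C & forall g s, sum_set A0 A1 g -> 0 < s ->
    ((s `^ (- sigma) * c s)%:E * Kfun A0 A1 s g <= C%:E * qnorm X g)%E.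

Definition class_J (X : qspace V) (sigma : R) (c : R -> R) : Prop :=
  forall d : R, 0 < d -> exists2 C : R, 0 < C & forall g t B, sum_set A0 A1 g ->
    0 < t -> 0 <= B ->
    (forall u, 0 < u -> (Kfun A0 A1 u g <=
       (B * (u `^ sigma / c u) * expR (- d * `|ln u - ln t|))%:E)%E) ->
    (qnorm X g <= (C * B)%:E)%E.

Hypotheses (hK0 : class_K X0 s0 c0) (hK1 : class_K X1 s1 c1).
Hypotheses (hJ0 : class_J X0 s0 c0) (hJ1 : class_J X1 s1 c1).

Let rho t := t `^ (s1 - s0) * (c0 t / c1 t).
Let eta := (1 - theta) * s0 + theta * s1.
Let asharp t := c0 t `^ (1 - theta) * c1 t `^ theta * a (rho t).
(** The weight of the left-hand interpolation norm at the point [rho t]. *)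
Let w t := rho t `^ (- theta) * a (rho t).

Local Notation K := (Kfun A0 A1).
Local Notation KX := (Kfun X0 X1).

Lemma rv_rho : regularly_varying (s1 - s0) rho.
Proof.
have := rvM (rv_powid (s1 - s0)) (rvM rc0 (rv_inv rc1)).
by rewrite oppr0 !addr0.
Qed.

Lemma rho_gt0 t : 0 < t -> 0 < rho t.
Proof. by case: rv_rho => + _; apply. Qed.

Lemma c0_gt0 t : 0 < t -> 0 < c0 t. Proof. by case: rc0 => + _; apply. Qed.
Lemma c1_gt0 t : 0 < t -> 0 < c1 t. Proof. by case: rc1 => + _; apply. Qed.
Lemma a_gt0 t : 0 < t -> 0 < a t. Proof. by case: ra => + _; apply. Qed.

Lemma rv_w : regularly_varying (- theta * (s1 - s0)) w.
Proof.
by have := rvM (rv_powR (- theta) rv_rho) (rv_comp rv_rho ra); rewrite addr0.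
Qed.

Lemma w_gt0 t : 0 < t -> 0 < w t.
Proof. by case: rv_w => + _; apply. Qed.

Lemma ln_rho t : 0 < t -> ln (rho t) = (s1 - s0) * ln t + (ln (c0 t) - ln (c1 t)).
Proof.
move=> t0; have C0 := c0_gt0 t0; have C1 := c1_gt0 t0.
by rewrite /rho ln_powRM ?divr_gt0 // ln_div ?posrE.
Qed.

(** This identity is the origin of [eta] and [asharp]: the weight of the right-hand norm is [w]
    times the weight in the class (K) estimate for [X0]. *)
Lemma asharpE t : 0 < t -> t `^ (- eta) * asharp t = w t * (t `^ (- s0) * c0 t).
Proof.
move=> t0; have C0 := c0_gt0 t0; have C1 := c1_gt0 t0; have r0 := rho_gt0 t0.
rewrite /asharp /w mulrA [RHS]mulrAC; congr (_ * _).
apply: ln_inj; rewrite ?posrE ?mulr_gt0 ?powR_gt0 //.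
rewrite !ln_powRM ?mulr_gt0 ?powR_gt0 ?invr_gt0 ?mulr_gt0 ?divr_gt0 //.
rewrite ln_powR ln_div ?posrE // /eta; ring.
Qed.

(** [rho] is the quotient of the class weights of [X0] and [X1], so that at [rho t] the two endpoint
    estimates balance. *)
Lemma rho_shift t : 0 < t -> t `^ (- s0) * c0 t = rho t * (t `^ (- s1) * c1 t).
Proof.
move=> t0; have C0 := c0_gt0 t0; have C1 := c1_gt0 t0; have r0 := rho_gt0 t0.
have p0 : 0 < t `^ (- s0) * c0 t by rewrite mulr_gt0 ?powR_gt0.
have p1 : 0 < t `^ (- s1) * c1 t by rewrite mulr_gt0 ?powR_gt0.
apply: ln_inj; rewrite ?posrE //; first exact: mulr_gt0.
rewrite [RHS]lnM ?posrE // ln_rho // !ln_powRM //; ring.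
Qed.

Lemma rv_asharp : regularly_varying (- theta * (s1 - s0) + - s0)
  (fun t => w t * (t `^ (- s0) * c0 t)).
Proof.
by have := rvM rv_w (rvM (rv_powid (- s0)) rc0); rewrite addr0.
Qed.

(** The lower bound separates the images of the points [e^n] under [rho]; the upper bound separates
    approximate preimages of these points. *)
Lemma rho_dist : exists2 C : R, 0 <= C & forall s t, 0 < s -> 0 < t ->
  (s1 - s0) / 2 * `|ln s - ln t| - C <= `|ln (rho s) - ln (rho t)| /\
  `|ln (rho s) - ln (rho t)| <= 2 * (s1 - s0) * `|ln s - ln t| + C.
Proof.
have k0 : 0 < s1 - s0 by rewrite subr_gt0.
have k2 : 0 < (s1 - s0) / 2 by rewrite divr_gt0.
have [C C0 HC] := proj2 rv_rho _ k2; exists C => // s t S0 T0.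
have := HC s t S0 T0; set D := ln (rho s) - ln (rho t); set L := ln s - ln t => h.
have kL : `|(s1 - s0) * L| = (s1 - s0) * `|L| by rewrite normrM gtr0_norm.
have h1 : `|(s1 - s0) * L| <= `|D| + `|D - (s1 - s0) * L|.
  have e : (s1 - s0) * L = D - (D - (s1 - s0) * L) by ring.
  by rewrite [X in `|X| <= _]e; exact: ler_normB.
have h2 : `|D| <= `|(s1 - s0) * L| + `|D - (s1 - s0) * L|.
  rewrite -[X in `|X| <= _](subrK ((s1 - s0) * L)) [leRHS]addrC.
  exact: ler_normD.
have L0 := mulr_ge0 (ltW k0) (normr_ge0 L).
by split; lra.
Qed.

Lemma interp_normE (Y0 Y1 : qspace V) (th : R) (q : \bar R) (b : R -> R) f :
  interp_norm Y0 Y1 th q b f =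
  Lq_log `]0, +oo[%classic q (fun u => ((u `^ (- th) * b u)%:E * Kfun Y0 Y1 u f)%E).
Proof.
apply: eq_Lq => u /posI u0.
by rewrite powR_recip // -mulrA EFinM muleA.
Qed.

Definition cells (F : R -> \bar R) (n : int) : \bar R := F (expR n%:~R).

Lemma interp_norm_cells (Y0 Y1 : qspace V) (th k : R) (q : \bar R) (b : R -> R) :
  (0 < q)%E -> (forall x, carrier Y0 x -> (0 <= qnorm Y0 x)%E) ->
  (forall x, carrier Y1 x -> (0 <= qnorm Y1 x)%E) ->
  regularly_varying k (fun t => t `^ (- th) * b t) ->
  exists2 C : R, 0 < C & forall f,
    let F u := ((u `^ (- th) * b u)%:E * Kfun Y0 Y1 u f)%E in
    (interp_norm Y0 Y1 th q b f <= C%:E * lq q (cells F))%E /\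
    (lq q (cells F) <= C%:E * interp_norm Y0 Y1 th q b f)%E.
Proof.
move=> q0 N0 N1 rb.
have [M M0 HM] := Kfun_weight_local N0 N1 ler01 rb.
have [C C0 HC] := Lq_log_le_lq q0 M0; have [D D0 HD] := lq_le_Lq_log q0 M0.
have b0 u : 0 < u -> 0 < u `^ (- th) * b u by case: rb => + _; apply.
exists (C + D) => [|f F]; first exact: addr_gt0.
have F0 u : 0 < u -> (0 <= F u)%E.
  by move=> u0; rewrite mule_ge0 ?Kfun_ge0 // lee_fin ltW // b0.
have FM s t : 0 < s -> 0 < t -> `|ln s - ln t| <= 1 -> (F s <= M%:E * F t)%E.
  by move=> ? ? ?; exact: HM.
have lq0 : (0 <= lq q (cells F))%E.
  have c0' n : (0 <= cells F n)%E by rewrite F0 ?expR_gt0.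
  exact: le_trans (c0' 0) (lq_ge 0 q0 c0').
split; rewrite interp_normE.
  apply: (le_trans (HC F F0 FM)); apply: lee_wpmul2r => //.
  by rewrite lee_fin lerDl ltW.
apply: (le_trans (HD F F0 FM)); apply: lee_wpmul2r; first exact: Lq_ge0.
by rewrite lee_fin lerDr ltW.
Qed.

Lemma Kfun_le_KX : exists2 C : R, 0 < C & forall f u, 0 < u ->
  ((u `^ (- s0) * c0 u)%:E * K u f <= C%:E * KX (rho u) f)%E.
Proof.
have [C0 C00 H0] := hK0; have [C1 C10 H1] := hK1; have [CA CA0 HA] := Kfun_add hA.
have C01 : 0 < C0 + C1 by exact: addr_gt0.
exists (CA * (C0 + C1)) => [|f u u0]; first exact: mulr_gt0.
have CAC : 0 < CA * (C0 + C1) by exact: mulr_gt0.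
have x0 : 0 <= u `^ (- s0) * c0 u by rewrite mulr_ge0 ?powR_ge0 // ltW // c0_gt0.
have r0 := ltW (rho_gt0 u0).
rewrite -lee_pdivrMl //; apply: le_ereal_inf_tmp => _ [g [h [cg ch -> ->]]].
rewrite lee_pdivrMl //.
move: cg ch; rewrite X0E X1E /= => -[sg _] [sh _].
have Kg := Kfun_ge0_couple hA g u0; have Kh := Kfun_ge0_couple hA h u0.
apply: (@le_trans _ _ ((u `^ (- s0) * c0 u)%:E * (CA%:E * (K u g + K u h)))%E).
  by apply: lee_wpmul2l; [rewrite lee_fin|exact: HA].
rewrite muleCA (EFinM CA) -muleA; apply: lee_wpmul2l; first by rewrite lee_fin ltW.
rewrite ge0_muleDr // ge0_muleDr ?mule_ge0 ?lee_fin //.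
apply: leeD.
  apply: (le_trans (H0 g u sg u0)); apply: lee_wpmul2r => //.
  by rewrite lee_fin lerDl ltW.
rewrite rho_shift // EFinM -muleA.
rewrite [leRHS]muleCA; apply: lee_wpmul2l; first by rewrite lee_fin.
apply: (le_trans (H1 h u sh u0)); apply: lee_wpmul2r => //.
by rewrite lee_fin lerDr ltW.
Qed.

Lemma rv_theta : regularly_varying (- theta) (fun t => t `^ (- theta) * a t).
Proof. by have := rvM (rv_powid (- theta)) ra; rewrite addr0. Qed.

Lemma rv_eta :
  regularly_varying (- theta * (s1 - s0) + - s0) (fun t => t `^ (- eta) * asharp t).
Proof. by apply: rv_eq rv_asharp => t t0; rewrite asharpE. Qed.

Let A0_ge0 x : carrier A0 x -> (0 <= qnorm A0 x)%E.
Proof. by apply: qnorm_ge0; case: hA => _ []. Qed.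

Let A1_ge0 x : carrier A1 x -> (0 <= qnorm A1 x)%E.
Proof. by apply: qnorm_ge0; case: hA => _ []. Qed.

Lemma interp_norm_le_interp_norm : exists2 C : R, 0 < C & forall f,
  (interp_norm A0 A1 eta r asharp f <= C%:E * interp_norm X0 X1 theta r a f)%E.
Proof.
have [C1 C10 H1] := Kfun_le_KX.
have [Ca Ca0 HA] := interp_norm_cells r_gt0 A0_ge0 A1_ge0 rv_eta.
have [Cx Cx0 HX] :=
  interp_norm_cells r_gt0 (fun x _ => X0_ge0 x) (fun x _ => X1_ge0 x) rv_theta.
have [M M0 HM] :=
  Kfun_weight_local (fun x _ => X0_ge0 x) (fun x _ => X1_ge0 x) ler01 rv_theta.
have k0 : 0 < (s1 - s0) / 2 by rewrite divr_gt0 // subr_gt0.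
have [D D0 HD] := rho_dist.
pose phi (n : int) := ln (rho (expR n%:~R)).
have Hphi (n m : int) : (s1 - s0) / 2 * `|n%:~R - m%:~R| - D <= `|phi n - phi m|.
  by have [+ _] := HD _ _ (expR_gt0 n%:~R) (expR_gt0 m%:~R); rewrite !expRK.
(* The change of variable as a degenerate kernel: row [n] has the single entry [m], the integer part
   of [phi n]. The entry [e^(-1)] respects the required decay because [|phi n - m| < 1]; a factor
   [e] in the second sequence undoes it. *)
pose ker (n m : int) : R := if m == Num.floor (phi n) then expR (- 1) else 0.
have Hker n m : 0 <= ker n m <= expR (- 1 * `|phi n - m%:~R|).
  rewrite /ker; case: eqP => [->|_]; last by rewrite lexx expR_ge0.
  rewrite expR_ge0 /= ler_expR mulN1r lerN2.
  by have /andP[h1 h2] := floor_itv (phi n); rewrite intrD in h2; rewrite ger0_norm; lra.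
have [C2 C20 H2] := lq_sup_kernel r_gt0 ltr01 k0 Hphi Hker.
have e10 := expR_gt0 (1 : R).
exists (Ca * (C2 * ((C1 * M * expR 1) * Cx))) => [|f]; first by rewrite !mulr_gt0.
have [leA _] := HA f; have [_ leX] := HX f.
pose F u := ((u `^ (- eta) * asharp u)%:E * K u f)%E.
pose H u := ((u `^ (- theta) * a u)%:E * KX u f)%E.
have KX0 u : 0 < u -> (0 <= KX u f)%E by apply: Kfun_ge0 => x _.
have H0 u : 0 < u -> (0 <= H u)%E.
  move=> u0; rewrite mule_ge0 ?KX0 // lee_fin mulr_ge0 ?powR_ge0 // ltW //.
  exact: a_gt0.
have F0 u : 0 < u -> (0 <= F u)%E.
  move=> u0; rewrite mule_ge0 ?(Kfun_ge0_couple hA) // lee_fin asharpE //.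
  apply: mulr_ge0; first exact/ltW/w_gt0.
  by apply: mulr_ge0; [exact: powR_ge0|exact/ltW/c0_gt0].
have FH u : 0 < u -> (F u <= C1%:E * H (rho u))%E.
  move=> u0; rewrite /F asharpE // EFinM -muleA muleCA /H.
  rewrite [leRHS]muleCA muleCA; apply: lee_wpmul2l; last exact: H1.
  by rewrite lee_fin ltW // w_gt0.
apply: (le_trans leA); rewrite (EFinM Ca) -[leRHS]muleA.
apply: lee_wpmul2l; first by rewrite lee_fin ltW.
have y0 m : (0 <= (C1 * M * expR 1)%:E * cells H m)%E.
  by apply: mule_ge0; [rewrite lee_fin !mulr_ge0 // ltW|exact/H0/expR_gt0].
apply: (le_trans (H2 _ (fun m => (C1 * M * expR 1)%:E * cells H m)%E _ y0 _)).
- by move=> n; exact/F0/expR_gt0.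
- move=> n; apply: le_trans (FH _ (expR_gt0 _)) _.
  set m := Num.floor (phi n).
  apply: (@le_trans _ _ ((ker n m)%:E * ((C1 * M * expR 1)%:E * cells H m))%E); last first.
    by apply: ereal_sup_ubound; exists m.
  have ec : expR (- 1) * (C1 * M * expR 1) = C1 * M.
    by rewrite expRN; field; rewrite gt_eqF.
  rewrite /ker eqxx [leRHS]muleA -[X in (_ <= X * _)%E]EFinM ec (EFinM C1) -muleA; apply: lee_wpmul2l; first by rewrite lee_fin ltW.
  apply: HM; [exact/rho_gt0/expR_gt0|exact: expR_gt0|].
  rewrite expRK -/(phi n).
  by have /andP[h1 h2] := floor_itv (phi n); rewrite intrD in h2; rewrite ger0_norm -/m; lra.
rewrite (EFinM C2) -muleA; apply: lee_wpmul2l; first by rewrite lee_fin ltW.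
apply: (le_trans (lqZ _ _ _)) => //.
- by rewrite !mulr_gt0.
- by move=> n; exact/H0/expR_gt0.
rewrite (EFinM (C1 * M * expR 1)) -muleA; apply: lee_wpmul2l => //.
by rewrite lee_fin !mulr_ge0 // ltW.
Qed.

Lemma qnorm_opp (A : qspace V) x : quasi_banach A -> carrier A x ->
  carrier A (- x) /\ qnorm A (- x) = qnorm A x.
Proof.
move=> [[_ _ cZ] [[_ _ h _] _]] cx; rewrite -scaleN1r; split; first exact: cZ.
by rewrite h // normrN1 mul1e.
Qed.

(** Near-optimality gives [||f0|| <= 2 K(t, f)] and [||f1|| <= 2 K(t, f) / t], hence the two bounds
    through [K(t, f)]. For the other two, write [f0 = f - f1] or [f1 = f - f0]: the subtracted piece
    contributes at most [2 K(u, f)], by quasi-concavity for [u <= t] and monotonicity for [u >= t].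
    The 3 in the constant is [1 + 2]. *)
Lemma Kfun_pieces : exists2 C : R, 0 < C & forall f t, sum_set A0 A1 f -> 0 < t ->
  exists f0 f1, [/\ carrier A0 f0, carrier A1 f1, f = f0 + f1 &
    forall u, 0 < u ->
      [/\ u <= t -> (K u f0 <= C%:E * K u f)%E,
          t <= u -> (K u f0 <= C%:E * K t f)%E,
          t <= u -> (K u f1 <= C%:E * K u f)%E &
          u <= t -> (K u f1 <= (C * (u / t))%:E * K t f)%E]].
Proof.
have [qA0 qA1] : quasi_banach A0 /\ quasi_banach A1 by case: hA.
have [CA CA0 HA] := Kfun_add hA.
have C3 : 0 < CA * 3 by rewrite mulr_gt0.
exists (CA * 3 + 2) => [|f t sf t0]; first by rewrite addr_gt0.
have [f0 [f1 [c0' c1' fE le]]] := Kfun_decomposition hA t0 sf.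
exists f0, f1; split=> // u u0.
have Kf v : 0 < v -> (0 <= K v f)%E by move=> v0; exact: Kfun_ge0_couple.
have C3E : (0 <= (CA * 3)%:E)%E by rewrite lee_fin ltW.
have n0 : (qnorm A0 f0 <= 2%:E * K t f)%E.
  by apply: le_trans le; rewrite leeDl // mule_ge0 ?A1_ge0 // lee_fin ltW.
have n1 : (u%:E * qnorm A1 f1 <= (2 * (u / t))%:E * K t f)%E.
  rewrite mulrC -mulrA EFinM -muleA; apply: lee_wpmul2l; first by rewrite lee_fin ltW.
  rewrite EFinM -muleA -lee_pdivrMl ?invr_gt0 // invrK.
  by apply: le_trans le; rewrite leeDr // A0_ge0.
have two v x : 0 < v -> (x <= 2%:E * K v f)%E -> (x <= (CA * 3 + 2)%:E * K v f)%E.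
  move=> v0 /le_trans; apply; apply: lee_wpmul2r; first exact: Kf.
  by rewrite lee_fin lerDr ltW.
have three v x y : 0 < v -> (x <= CA%:E * (K v f + y))%E -> (y <= 2%:E * K v f)%E ->
    (x <= (CA * 3 + 2)%:E * K v f)%E.
  move=> v0 hx hy; apply: (le_trans hx).
  apply: (@le_trans _ _ (CA%:E * (3%:E * K v f))%E).
    apply: lee_wpmul2l; first by rewrite lee_fin ltW.
    rewrite (_ : 3 = 1 + 2); last by ring.
    rewrite EFinD ge0_muleDl ?lee_fin // mul1e; exact: leeD.
  rewrite muleA -EFinM; apply: lee_wpmul2r; first exact: Kf.
  by rewrite lee_fin lerDl.
split=> ut.
- have e : f0 = f + - f1 by rewrite fE addrK.
  have [cN NN] := qnorm_opp qA1 c1'.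
  apply: (three u _ (K u (- f1)) u0).
    by rewrite {1}e; apply: HA => //; exact: sum_setr.
  apply: (le_trans (Kfun_ler hA u cN)); rewrite NN; apply: (le_trans n1).
  rewrite EFinM -muleA; apply: lee_wpmul2l; first by rewrite lee_fin.
  have := Kfun_scale A0_ge0 A1_ge0 f u0 ut.
  rewrite -[X in (_ -> X * _ <= _)%E]/((u / t)%:E) => h.
  by rewrite -lee_pdivlMl ?divr_gt0 // invf_div.
- apply: two => //; exact: le_trans (Kfun_lel hA u c0') n0.
- have e : f1 = f + - f0 by rewrite fE addrAC subrr add0r.
  have [cN NN] := qnorm_opp qA0 c0'.
  apply: (three u _ (K u (- f0)) u0).
    by rewrite {1}e; apply: HA => //; exact: sum_setl.
  apply: (le_trans (Kfun_lel hA u cN)); rewrite NN; apply: (le_trans n0).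
  by apply: lee_wpmul2l; [rewrite lee_fin|exact: Kfun_mono].
- apply: (le_trans (Kfun_ler hA u c1')); apply: (le_trans n1).
  apply: lee_wpmul2r; first exact: Kf.
  rewrite lee_fin; apply: ler_wpM2r; first by rewrite divr_ge0 // ltW.
  by rewrite lerDr ltW.
Qed.

(* [f0] and [f1] are the pieces of a near-optimal decomposition at [t]. The
   growth allowed for [K(u, f)] is beaten on each side of [t] by the weights:
   by [rho ^ theta] and [u ^ s0] for [f0], by [rho ^ (1 - theta)] and
   [u ^ (1 - s1)] for [f1]. *)
Lemma KX_le (d : R) : 0 < d -> 3 * d <= theta * (s1 - s0) ->
  3 * d <= (1 - theta) * (s1 - s0) -> 2 * d <= s0 -> 2 * d <= 1 - s1 ->
  exists2 C : R, 0 < C & forall f t B, sum_set A0 A1 f -> 0 < t -> 0 <= B ->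
    (forall u, 0 < u -> ((u `^ (- eta) * asharp u)%:E * K u f <=
       (B * expR (d * `|ln u - ln t|))%:E)%E) ->
    sum_set X0 X1 f /\ ((w t)%:E * KX (rho t) f <= (C * B)%:E)%E.
Proof.
move=> d0 d1 d2 d3 d4.
(* [v] plays for [X1] the role of [w] for [X0]: the weight [u^(-eta) asharp u] equals both [w / P0]
   and [v / P1]. *)
pose v t := w t * rho t.
have rv_v : regularly_varying (- theta * (s1 - s0) + (s1 - s0)) v := rvM rv_w rv_rho.
pose P0 u := u `^ s0 / c0 u; pose P1 u := u `^ s1 / c1 u.
have rP0 : regularly_varying s0 P0.
  by have := rvM (rv_powid s0) (rv_inv rc0); rewrite oppr0 addr0.
have rP1 : regularly_varying s1 P1.
  by have := rvM (rv_powid s1) (rv_inv rc1); rewrite oppr0 addr0.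
have [Cw Cw0 Hw] := rv_bound (rv_inv rv_w) d0.
have [Cv Cv0 Hv] := rv_bound (rv_inv rv_v) d0.
have [D0 D00 HD0] := rv_bound rP0 d0.
have [D1 D10 HD1] := rv_bound rP1 d0.
have [CP CP0 HP] := Kfun_pieces.
have [J0 J00 HJ0] := hJ0 d0; have [J1 J10 HJ1] := hJ1 d0.
pose Q0 := CP * (Cw + D0); pose Q1 := CP * (Cv + D1).
have Q00 : 0 < Q0 by rewrite mulr_gt0 // addr_gt0.
have Q10 : 0 < Q1 by rewrite mulr_gt0 // addr_gt0.
exists (J0 * Q0 + J1 * Q1) => [|f t B sf t0 B0 HB].
  by rewrite addr_gt0 // mulr_gt0.
have w0 := w_gt0; have rh0 := rho_gt0.
have v0 u : 0 < u -> 0 < v u by move=> u0; rewrite mulr_gt0 ?w0 ?rh0.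
have P00 u : 0 < u -> 0 < P0 u by case: rP0 => + _; apply.
have P10 u : 0 < u -> 0 < P1 u by case: rP1 => + _; apply.
have Kk u : 0 < u -> K u f = (fine (K u f))%:E by move=> u0; rewrite fineK ?Kfun_fin.
have k0 u : 0 < u -> 0 <= fine (K u f).
  by move=> u0; rewrite fine_ge0 // Kfun_ge0_couple.
have W0 u : 0 < u -> u `^ (- eta) * asharp u = w u / P0 u.
  move=> u0; rewrite asharpE // /P0 powRN invf_div; congr (_ * _).
  by rewrite mulrC.
have W1 u : 0 < u -> u `^ (- eta) * asharp u = v u / P1 u.
  move=> u0; rewrite asharpE // rho_shift // /P1 powRN invf_div mulrA; congr (_ * _).
  by rewrite mulrC.
have kB0 u : 0 < u -> fine (K u f) <= B * expR (d * `|ln u - ln t|) * (w u)^-1 * P0 u.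
  move=> u0; have := HB u u0; rewrite Kk // W0 // -EFinM lee_fin => h.
  rewrite -ler_pdivrMr ?P00 // ler_pdivlMr ?w0 //; apply: le_trans h.
  by rewrite le_eqVlt; apply/orP; left; apply/eqP; ring.
have kB1 u : 0 < u -> fine (K u f) <= B * expR (d * `|ln u - ln t|) * (v u)^-1 * P1 u.
  move=> u0; have := HB u u0; rewrite Kk // W1 // -EFinM lee_fin => h.
  rewrite -ler_pdivrMr ?P10 // ler_pdivlMr ?v0 //; apply: le_trans h.
  by rewrite le_eqVlt; apply/orP; left; apply/eqP; ring.
have [f0 [f1 [cf0 cf1 fE HPf]]] := HP f t sf t0.
have iw u : 0 < u -> 0 <= (w u)^-1 by move=> u0; rewrite invr_ge0 ltW // w0.
have iv u : 0 < u -> 0 <= (v u)^-1 by move=> u0; rewrite invr_ge0 ltW // v0.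
(* The gain [theta (s1 - s0)] from [1/w] must cover three rates [d]: the growth allowed in the
   hypothesis, the error in Potter's bound, and the decay to be kept. This is the origin of
   [3 * d]. *)
have near_w u : 0 < u -> ln u <= ln t ->
    fine (K u f) <= Cw * (B / w t * P0 u * expR (- d * `|ln u - ln t|)).
  move=> u0 lut; have D_ge0 : 0 <= ln t - ln u by rewrite subr_ge0.
  have adist : `|ln u - ln t| = ln t - ln u by rewrite ler0_norm ?subr_le0 // opprB.
  apply: (le_trans (kB0 u u0)).
  have := Hw u t u0 t0; rewrite adist => h.
  apply: (@le_trans _ _ (B * expR (d * (ln t - ln u)) *
    (Cw * expR (- (- theta * (s1 - s0)) * (ln u - ln t) + d * (ln t - ln u)) * (w t)^-1) * P0 u)).
    apply: ler_wpM2r; first exact/ltW/P00.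
    by apply: ler_wpM2l => //; rewrite mulr_ge0 // expR_ge0.
  rewrite [leLHS](_ : _ = Cw * (B / w t * P0 u * (expR (d * (ln t - ln u)) *
    expR (- (- theta * (s1 - s0)) * (ln u - ln t) + d * (ln t - ln u))))); last by ring.
  apply: ler_wpM2l; first exact: ltW.
  apply: ler_wpM2l; first by apply: mulr_ge0 (ltW (P00 u u0)); rewrite mulr_ge0 ?iw.
  rewrite -expRD ler_expR; have := ler_wpM2r D_ge0 d1; nra.
have near_v u : 0 < u -> ln t <= ln u ->
    fine (K u f) <= Cv * (B / v t * P1 u * expR (- d * `|ln u - ln t|)).
  move=> u0 lut; have D_ge0 : 0 <= ln u - ln t by rewrite subr_ge0.
  have adist : `|ln u - ln t| = ln u - ln t by rewrite ger0_norm.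
  apply: (le_trans (kB1 u u0)).
  have := Hv u t u0 t0; rewrite adist => h.
  apply: (@le_trans _ _ (B * expR (d * (ln u - ln t)) *
    (Cv * expR (- (- theta * (s1 - s0) + (s1 - s0)) * (ln u - ln t) + d * (ln u - ln t)) *
      (v t)^-1) * P1 u)).
    apply: ler_wpM2r; first exact/ltW/P10.
    by apply: ler_wpM2l => //; rewrite mulr_ge0 // expR_ge0.
  rewrite [leLHS](_ : _ = Cv * (B / v t * P1 u * (expR (d * (ln u - ln t)) *
    expR (- (- theta * (s1 - s0) + (s1 - s0)) * (ln u - ln t) + d * (ln u - ln t)))));
    last by ring.
  apply: ler_wpM2l; first exact: ltW.
  apply: ler_wpM2l; first by apply: mulr_ge0 (ltW (P10 u u0)); rewrite mulr_ge0 ?iv.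
  rewrite -expRD ler_expR; have := ler_wpM2r D_ge0 d2; nra.
(* Here the hypothesis is used at [t] itself, where it allows no growth, so the gain [s0] has to
   cover only [2 * d]. *)
have far_w u : 0 < u -> ln t <= ln u ->
    fine (K t f) <= D0 * (B / w t * P0 u * expR (- d * `|ln u - ln t|)).
  move=> u0 lut; have D_ge0 : 0 <= ln u - ln t by rewrite subr_ge0.
  have := kB0 t t0; rewrite subrr normr0 mulr0 expR0 mulr1 => h.
  apply: (le_trans h).
  have := HD0 t u t0 u0; rewrite distrC ger0_norm // => h'.
  apply: (@le_trans _ _ (B / w t *
      (D0 * expR (s0 * (ln t - ln u) + d * (ln u - ln t)) * P0 u))).
    by apply: ler_wpM2l => //; rewrite mulr_ge0 ?iw.
  rewrite [leLHS](_ : _ = D0 * (B / w t * P0 u *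
    expR (s0 * (ln t - ln u) + d * (ln u - ln t)))); last by ring.
  apply: ler_wpM2l; first exact: ltW.
  apply: ler_wpM2l; first by apply: mulr_ge0 (ltW (P00 u u0)); rewrite mulr_ge0 ?iw.
  rewrite ler_expR; have := ler_wpM2r D_ge0 d3; nra.
(* The factor [u/t] decays at rate 1 and [P1] gives back [s1]; the difference [1 - s1] has to cover
   [2 * d]. *)
have far_v u : 0 < u -> ln u <= ln t ->
    u / t * fine (K t f) <= D1 * (B / v t * P1 u * expR (- d * `|ln u - ln t|)).
  move=> u0 lut; have D_ge0 : 0 <= ln t - ln u by rewrite subr_ge0.
  have adist : `|ln u - ln t| = ln t - ln u by rewrite ler0_norm ?subr_le0 // opprB.
  have ut0 : 0 < u / t by rewrite divr_gt0.
  have utE : u / t = expR (- (ln t - ln u)).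
    by rewrite opprB -ln_div ?posrE // lnK // posrE.
  have := kB1 t t0; rewrite subrr normr0 mulr0 expR0 mulr1 => h.
  apply: (le_trans (ler_wpM2l (ltW ut0) h)).
  have := HD1 t u t0 u0; rewrite distrC adist => h'.
  apply: (@le_trans _ _ (u / t * (B / v t *
      (D1 * expR (s1 * (ln t - ln u) + d * (ln t - ln u)) * P1 u)))).
    apply: ler_wpM2l; first exact: ltW.
    by apply: ler_wpM2l => //; rewrite mulr_ge0 ?iv.
  rewrite utE [leLHS](_ : _ = D1 * (B / v t * P1 u * (expR (- (ln t - ln u)) *
    expR (s1 * (ln t - ln u) + d * (ln t - ln u))))); last by ring.
  apply: ler_wpM2l; first exact: ltW.
  apply: ler_wpM2l; first by apply: mulr_ge0 (ltW (P10 u u0)); rewrite mulr_ge0 ?iv.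
  rewrite -expRD ler_expR; have := ler_wpM2r D_ge0 d4; nra.
have E0 (b0 : R) (Z : R) u : 0 <= b0 -> 0 <= Z -> 0 <= b0 * Z * expR (- d * `|ln u - ln t|).
  by move=> ? ?; rewrite !mulr_ge0 // expR_ge0.
have Bw : 0 <= B / w t by rewrite mulr_ge0 ?iw.
have Bv : 0 <= B / v t by rewrite mulr_ge0 ?iv.
have bound0 : (qnorm X0 f0 <= (J0 * (Q0 * (B / w t)))%:E)%E.
  apply: (HJ0 _ t) => //; first exact: (sum_setl hA).
    by rewrite mulr_ge0 // ltW.
  move=> u u0; have [h1 h2 _ _] := HPf u u0; rewrite -/(P0 u).
  set E := expR _; have e0 := E0 (B / w t) (P0 u) u Bw (ltW (P00 u u0)); rewrite -/E in e0.
  rewrite (_ : Q0 * (B / w t) * P0 u * E = CP * ((Cw + D0) * (B / w t * P0 u * E)));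
    last by rewrite /Q0; ring.
  have [ut|/ltW tu] := leP u t.
    apply: (le_trans (h1 ut)); rewrite Kk // -EFinM lee_fin.
    apply: ler_wpM2l; first exact: ltW.
    apply: (le_trans (near_w u u0 _)); first by rewrite ler_ln.
    by rewrite -/E; apply: ler_wpM2r => //; rewrite lerDl ltW.
  apply: (le_trans (h2 tu)); rewrite Kk // -EFinM lee_fin.
  apply: ler_wpM2l; first exact: ltW.
  apply: (le_trans (far_w u u0 _)); first by rewrite ler_ln.
  by rewrite -/E; apply: ler_wpM2r => //; rewrite lerDr ltW.
have bound1 : (qnorm X1 f1 <= (J1 * (Q1 * (B / v t)))%:E)%E.
  apply: (HJ1 _ t) => //; first exact: (sum_setr hA).
    by rewrite mulr_ge0 // ltW.
  move=> u u0; have [_ _ h1 h2] := HPf u u0; rewrite -/(P1 u).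
  set E := expR _; have e0 := E0 (B / v t) (P1 u) u Bv (ltW (P10 u u0)); rewrite -/E in e0.
  rewrite (_ : Q1 * (B / v t) * P1 u * E = CP * ((Cv + D1) * (B / v t * P1 u * E)));
    last by rewrite /Q1; ring.
  have [ut|/ltW tu] := leP u t.
    apply: (le_trans (h2 ut)); rewrite Kk // -EFinM lee_fin -[leLHS]mulrA.
    apply: ler_wpM2l; first exact: ltW.
    apply: (le_trans (far_v u u0 _)); first by rewrite ler_ln.
    by rewrite -/E; apply: ler_wpM2r => //; rewrite lerDr ltW.
  apply: (le_trans (h1 tu)); rewrite Kk // -EFinM lee_fin.
  apply: ler_wpM2l; first exact: ltW.
  apply: (le_trans (near_v u u0 _)); first by rewrite ler_ln.
  by rewrite -/E; apply: ler_wpM2r => //; rewrite lerDl ltW.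
have cX0 : carrier X0 f0.
  by rewrite X0E; split; [exact: (sum_setl hA)|apply: le_lt_trans bound0 _; exact: ltry].
have cX1 : carrier X1 f1.
  by rewrite X1E; split; [exact: (sum_setr hA)|apply: le_lt_trans bound1 _; exact: ltry].
split; first by exists f0, f1.
(* As [v t = w t * rho t], both pieces contribute a constant multiple of [B]. *)
have wt0 := w0 t t0; have rt0 := rh0 t t0.
apply: (@le_trans _ _ ((w t)%:E *
   ((J0 * (Q0 * (B / w t)))%:E + (rho t)%:E * (J1 * (Q1 * (B / v t)))%:E))%E).
  apply: lee_wpmul2l; first by rewrite lee_fin ltW.
  rewrite fE; apply: (le_trans (Kfun_le _ cX0 cX1)); apply: leeD => //.
  by apply: lee_wpmul2l; [rewrite lee_fin ltW|].
rewrite -(EFinM (rho t)) -EFinD -(EFinM (w t)) lee_fin /v le_eqVlt; apply/orP; left; apply/eqP.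
by field; rewrite !gt_eqF.
Qed.

Lemma interp_norm_ge_interp_norm : exists2 C : R, 0 < C & forall f,
  sum_set A0 A1 f -> (interp_norm A0 A1 eta r asharp f < +oo)%E ->
  sum_set X0 X1 f /\
  (interp_norm X0 X1 theta r a f <= C%:E * interp_norm A0 A1 eta r asharp f)%E.
Proof.
have k0 : 0 < s1 - s0 by rewrite subr_gt0.
pose d := Num.min (Num.min (theta * (s1 - s0) / 3) ((1 - theta) * (s1 - s0) / 3))
                  (Num.min (s0 / 2) ((1 - s1) / 2)).
have d0 : 0 < d by rewrite !lt_min !divr_gt0 ?mulr_gt0 ?subr_gt0.
have d1 : d <= theta * (s1 - s0) / 3 by rewrite !ge_min lexx.
have d2 : d <= (1 - theta) * (s1 - s0) / 3 by rewrite !ge_min lexx ?orbT.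
have d3 : d <= s0 / 2 by rewrite !ge_min lexx ?orbT.
have d4 : d <= (1 - s1) / 2 by rewrite !ge_min lexx ?orbT.
have [||||C1 C10 H1] := KX_le d0; try lra.
have [Ca Ca0 HA] := interp_norm_cells r_gt0 A0_ge0 A1_ge0 rv_eta.
have [Cx Cx0 HX] :=
  interp_norm_cells r_gt0 (fun x _ => X0_ge0 x) (fun x _ => X1_ge0 x) rv_theta.
have [M M0 HM] := Kfun_weight_local A0_ge0 A1_ge0 ler01 rv_eta.
have [L L0 HL] := rv_onto k0 rv_rho.
have [M2 M20 HM2] :=
  Kfun_weight_local (fun x _ => X0_ge0 x) (fun x _ => X1_ge0 x) L0 rv_theta.
have [D D0 HD] := rho_dist.
(* [tau m] replaces the preimage of [e^m] under [rho], up to a factor [e^L]. *)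
have /choice[tau Htau] : forall m : int, exists t, 0 < t /\ `|ln (rho t) - m%:~R| <= L.
  by move=> m; have [t t0 ht] := HL m%:~R; exists t.
pose phi (m : int) := ln (tau m).
pose k := (2 * (s1 - s0))^-1.
have kpos : 0 < k by rewrite invr_gt0 mulr_gt0.
have Hphi (n m : int) : k * `|n%:~R - m%:~R| - k * (2 * L + D) <= `|phi n - phi m|.
  have [n0 hn] := Htau n; have [m0 hm] := Htau m.
  have [_ h] := HD _ _ n0 m0.
  rewrite -mulrBr /k -[leLHS]mulrC ler_pdivrMr ?mulr_gt0 //.
  have h3 : `|n%:~R - m%:~R : R| <=
      `|ln (rho (tau n)) - n%:~R| + `|ln (rho (tau n)) - ln (rho (tau m))| +
      `|ln (rho (tau m)) - m%:~R|.
    rewrite (_ : n%:~R - m%:~R = - (ln (rho (tau n)) - n%:~R) +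
      (ln (rho (tau n)) - ln (rho (tau m))) + (ln (rho (tau m)) - m%:~R)); last by ring.
    by apply: (le_trans (ler_normD _ _)); rewrite lerD2r;
      apply: (le_trans (ler_normD _ _)); rewrite normrN.
  rewrite /phi; lra.
pose ker (m n : int) := expR (- d * `|phi m - n%:~R|).
have Hker m n : 0 <= ker m n <= expR (- d * `|phi m - n%:~R|).
  by rewrite /ker expR_ge0 lexx.
have [C2 C20 H2] := lq_sup_kernel r_gt0 d0 kpos Hphi Hker.
pose Q := M2 * (C1 * (M * expR d)).
have Q0 : 0 < Q by rewrite !mulr_gt0 ?expR_gt0.
exists (Cx * (C2 * (Q * Ca))) => [|f sf ffin]; first by rewrite !mulr_gt0 ?expR_gt0.
have [_ leA] := HA f; have [leX _] := HX f.
pose G u := ((u `^ (- eta) * asharp u)%:E * K u f)%E.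
pose H u := ((u `^ (- theta) * a u)%:E * KX u f)%E.
have G0 u : 0 < u -> (0 <= G u)%E.
  move=> u0; apply: mule_ge0; last exact: (Kfun_ge0_couple hA f u0).
  by rewrite lee_fin ltW //; case: rv_eta => + _; apply.
have cG0 n : (0 <= cells G n)%E by exact/G0/expR_gt0.
have H0 u : 0 < u -> (0 <= H u)%E.
  move=> u0; apply: mule_ge0; last by apply: (Kfun_ge0 (fun x _ => X0_ge0 x) (fun x _ => X1_ge0 x)).
  by rewrite lee_fin ltW //; case: rv_theta => + _; apply.
have lqfin : (lq r (cells G) < +oo)%E.
  by apply: (le_lt_trans leA); apply: lte_mul_pinfty => //; rewrite lee_fin ltW.
have key t : 0 < t -> sum_set X0 X1 f /\ ((w t)%:E * KX (rho t) f <=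
    (C1 * (M * expR d))%:E *
    ereal_sup (range (fun n : int => (expR (- d * `|ln t - n%:~R|))%:E * cells G n)))%E.
  move=> t0; set S := ereal_sup _.
  have term n : ((expR (- d * `|ln t - n%:~R|))%:E * cells G n <= S)%E.
    by apply: ereal_sup_ubound; exists n.
  have S0 : (0 <= S)%E by apply: le_trans (term 0); rewrite mule_ge0 // lee_fin expR_ge0.
  (* The bound [B] of [KX_le] is a real number; this is where finiteness of the norm of [f] enters,
     every term being at most the sequence norm of [cells G]. *)
  have Sfin : S \is a fin_num.
    rewrite ge0_fin_numE //; apply: le_lt_trans lqfin.
    apply: ge_ereal_sup => _ [n _ <-]; apply: le_trans (lq_ge n r_gt0 cG0).
    rewrite -[leRHS]mul1e; apply: lee_wpmul2r => //.
    by rewrite lee_fin -[leRHS]expR0 ler_expR mulNr oppr_le0 mulr_ge0 // ltW.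
  have B0 : 0 <= M * expR d * fine S.
    by rewrite !mulr_ge0 ?expR_ge0 ?fine_ge0 // ltW.
  have [|sX le] := H1 f t _ sf t0 B0.
    (* Passing from [u] to [e^n] costs [M] for the weighted K-functional and [e^d] for the kernel,
       since [|ln u - n| <= 1]. *)
    move=> u u0; set n := Num.floor (ln u).
    have cu := floor_cell u0; have nu := ln_cell_near cu.
    apply: (le_trans (HM f _ _ u0 (expR_gt0 _) nu)).
    rewrite -!(mulrA M) (EFinM M); apply: lee_wpmul2l; first by rewrite lee_fin ltW.
    have := term n; rewrite -lee_pdivlMl ?expR_gt0 // -expRN mulNr opprK => h.
    apply: (le_trans h); rewrite -{1}(fineK Sfin) -EFinM lee_fin.
    rewrite [leRHS](_ : _ = expR d * expR (d * `|ln u - ln t|) * fine S); last by ring.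
    apply: ler_wpM2r; first by rewrite fine_ge0.
    rewrite -expRD ler_expR -[X in _ <= X + _]mulr1 -mulrDr.
    apply: ler_wpM2l; first exact: ltW.
    rewrite expRK in nu.
    rewrite (_ : ln t - n%:~R = (ln u - n%:~R) - (ln u - ln t)); last by ring.
    by apply: (le_trans (ler_normB _ _)); rewrite lerD2r.
  split=> //; apply: (le_trans le).
  by rewrite -[X in (_ <= _ * X)%E](fineK Sfin) -EFinM lee_fin mulrA.
(* The point 1 is arbitrary: a decomposition at any [t] puts [f] in the sum of [X0] and [X1]. *)
split; first by have [] := key 1 ltr01.
apply: (le_trans leX); rewrite (EFinM Cx) -muleA.
apply: lee_wpmul2l; first by rewrite lee_fin ltW.
have y0 n : (0 <= Q%:E * cells G n)%E by rewrite mule_ge0 // lee_fin ltW.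
apply: (le_trans (H2 _ (fun n => Q%:E * cells G n)%E _ y0 _)).
- by move=> m; exact/H0/expR_gt0.
- move=> m; have [t0 hm] := Htau m.
  have rt0 := rho_gt0 t0.
  have near : `|ln (expR m%:~R) - ln (rho (tau m))| <= L by rewrite expRK distrC.
  apply: (le_trans (HM2 f _ _ (expR_gt0 _) rt0 near)).
  have [_ le] := key _ t0.
  apply: (@le_trans _ _ (M2%:E * ((C1 * (M * expR d))%:E *
     ereal_sup (range (fun n : int => (expR (- d * `|ln (tau m) - n%:~R|))%:E * cells G n))))%E).
    by apply: lee_wpmul2l; [rewrite lee_fin ltW|exact: le].
  rewrite muleA -(EFinM M2) -/Q -lee_pdivlMl //.
  apply: ge_ereal_sup => _ [n _ <-]; rewrite lee_pdivlMl //.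
  by apply: ereal_sup_ubound; exists n => //=; rewrite muleCA.
rewrite (EFinM C2) -muleA; apply: lee_wpmul2l; first by rewrite lee_fin ltW.
apply: (le_trans (lqZ r_gt0 Q0 cG0)).
by rewrite (EFinM Q) -muleA; apply: lee_wpmul2l; first by rewrite lee_fin ltW.
Qed.

Theorem reiteration : space_iso (interp X0 X1 theta r a) (interp A0 A1 eta r asharp).
Proof.
have [C C0 HC] := interp_norm_le_interp_norm.
have [D D0 HD] := interp_norm_ge_interp_norm.
split; split.
- move=> f [[g [h [cg ch ->]]] ffin]; split.
    move: cg ch; rewrite X0E X1E => -[sg _] [sh _]; exact: (sum_setD hA).
  by apply: (le_lt_trans (HC _)); apply: lte_mul_pinfty => //; rewrite lee_fin ltW.
- by exists C; split=> // f _; exact: HC.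
- move=> f [sf ffin]; have [sX le] := HD f sf ffin; split=> //.
  by apply: (le_lt_trans le); apply: lte_mul_pinfty => //; rewrite lee_fin ltW.
- by exists D; split=> // f [sf ffin]; have [] := HD f sf ffin.
Qed.

End Reiteration.

(** * Membership of the spaces of type L in the two classes, and the conclusion *)

Section InterpL.
Context {R : realType} (V : topologicalLmodType R) (A0 A1 : qspace V).
Context (sigma : R) (r : \bar R) (b : R -> R) (q : \bar R) (a : R -> R).
Hypotheses (hA : compatible_couple A0 A1) (r0 : (0 < r)%E) (q0 : (0 < q)%E).
Hypotheses (ha : slowly_varying a) (hb : slowly_varying b).
Hypothesis htail : (tail_norm r b a 1 < +oo)%E.

Lemma interpL_normE f : interpL_norm A0 A1 sigma r b q a f =
  normL sigma r b q a (fun u => Kfun A0 A1 u f).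
Proof.
apply: eq_Lq => t /posI t0; rewrite [RHS]muleA -EFinM; congr (_ * _)%E.
apply: eq_Lq => u; rewrite /= in_itv /= => /andP[u0 _].
by rewrite powR_recip // -mulrA EFinM muleA.
Qed.

Let A0_ge0 x : carrier A0 x -> (0 <= qnorm A0 x)%E.
Proof. by apply: qnorm_ge0; case: hA => _ []. Qed.

Let A1_ge0 x : carrier A1 x -> (0 <= qnorm A1 x)%E.
Proof. by apply: qnorm_ge0; case: hA => _ []. Qed.

Lemma interpL_class_K : class_K A0 A1 (interpL A0 A1 sigma r b q a) sigma
  (tail_weight r b a).
Proof.
have [C C0 HC] := classK sigma r0 q0 ha hb htail; exists C => // g s sg s0.
rewrite /= interpL_normE; apply: HC => //.
- by move=> u u0; exact: Kfun_ge0.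
- exact: Kfun_fin.
- by move=> u u0 us; exact: Kfun_scale.
Qed.

Lemma interpL_class_J : class_J A0 A1 (interpL A0 A1 sigma r b q a) sigma
  (tail_weight r b a).
Proof.
move=> d d0; have [C C0 HC] := classJ sigma r0 q0 ha hb htail d0.
exists C => // g t B sg t0 B0 HB; rewrite /= interpL_normE.
by apply: (HC _ t) => // u u0; exact: Kfun_ge0.
Qed.

End InterpL.

Theorem theorem25 (R : realType) (V : topologicalLmodType R)
  (A0 A1 : qspace V)
  (hA : compatible_couple A0 A1)
  (hI : exists x : V, [/\ carrier A0 x, carrier A1 x & x <> 0])
  (theta0 theta1 theta : R)
  (htheta0 : 0 < theta0) (htheta01 : theta0 < theta1) (htheta1 : theta1 < 1)
  (htheta_gt0 : 0 < theta) (htheta_lt1 : theta < 1)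
  (r r0 r1 q0 q1 : \bar R)
  (hr : (0 < r)%E) (hr0 : (0 < r0)%E) (hr1 : (0 < r1)%E)
  (hq0 : (0 < q0)%E) (hq1 : (0 < q1)%E)
  (a a0 a1 b0 b1 : R -> R)
  (ha : slowly_varying a)
  (ha0 : slowly_varying a0) (ha1 : slowly_varying a1)
  (hb0 : slowly_varying b0) (hb1 : slowly_varying b1)
  (htail0 : (tail_norm r0 b0 a0 1 < +oo)%E)
  (htail1 : (tail_norm r1 b1 a1 1 < +oo)%E) :
  let c0 := tail_weight r0 b0 a0 in
  let c1 := tail_weight r1 b1 a1 in
  let rho := fun t : R => t `^ (theta1 - theta0) * (c0 t / c1 t) in
  let eta := (1 - theta) * theta0 + theta * theta1 in
  let a_sharp := fun t : R => c0 t `^ (1 - theta) * c1 t `^ theta * a (rho t) in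
  space_iso
    (interp (interpL A0 A1 theta0 r0 b0 q0 a0) (interpL A0 A1 theta1 r1 b1 q1 a1)
       theta r a)
    (interp A0 A1 eta r a_sharp).
Proof.
move=> c0 c1 rho eta a_sharp.
apply: reiteration => //.
- exact: rv_tail_weight.
- exact: rv_tail_weight.
- exact: slowly_varying_rv.
- by move=> g; exact: Lq_ge0.
- by move=> g; exact: Lq_ge0.
- exact: interpL_class_K.
- exact: interpL_class_K.
- exact: interpL_class_J.
- exact: interpL_class_J.
Qed.
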